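(* Let $P$ be a random discrete distribution, let $F(v):=F_P[0,v]$, $0\le v\le 1$, be the associated random cumulative distribution function with exchangeable increments on $[0,1]$, and let $K_n$ be the number of distinct values in a random sample of size $n$ from either $P$ or $F$. Then for each $n\ge 1$ the $n$th moment of $F(v)$ is a polynomial in $v$ of degree at most $n$, which equals the probability generating function of $K_n$ evaluated at $v$: $$\mathbb{E}[F(v)]^n=\mathbb{E}\,v^{K_n}=\sum_{k=1}^n\mathbb{P}(K_n=k)\,v^k\qquad(0\le v\le 1),$$ where $$\mathbb{P}(K_n=k)=\sum_{(n_1,\ldots,n_k)}p^{\rm ex}(n_1,\ldots,n_k),$$ the sum being over all $\binom{n-1}{k-1}$ compositions $(n_1,\ldots,n_k)$ of $n$ into $k$ positive parts. Consequently, the collection of one-dimensional distributions of $K_n$, for $n=1,2,\ldots$, determines the collection of one-dimensional distributions of $F(v)$ for $0\le v\le 1$, and vice versa.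
   Context: A random discrete distribution is a sequence $P=(P_1,P_2,\ldots)$ of random variables with $P_j\ge 0$ and $\sum_j P_j=1$ almost surely. $F_P[0,v]=\sum_j P_j1(U_j\le v)$ with $U_1,U_2,\ldots$ i.i.d. uniform on $[0,1]$, independent of $P$. A random sample from $P$ (resp. $F$) is a sequence which, conditionally given $P$ (resp. $F$), is i.i.d. with distribution $P$ on the positive integers (resp. distribution $F$ on $[0,1]$). The exchangeable composition probability function (ECPF) of $P$ is $$p^{\rm ex}(n_1,\ldots,n_k)=\frac{1}{k!}\binom{n}{n_1,\ldots,n_k}p(n_1,\ldots,n_k),\qquad p(n_1,\ldots,n_k)=\sum_{(j_1,\ldots,j_k)}\mathbb{E}\prod_{i=1}^kP_{j_i}^{n_i},$$ where $n=n_1+\cdots+n_k$ and the last sum is over all sequences of $k$ distinct positive integers. *)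

(* Defs.v *)
From mathcomp Require Export all_boot all_order all_algebra.
From mathcomp Require Export all_classical all_reals all_analysis.
Export Order.TTheory GRing.Theory Num.Theory numFieldNormedType.Exports.

Set Implicit Arguments.
Unset Strict Implicit.
Unset Printing Implicit Defensive.

Local Open Scope classical_set_scope.
Local Open Scope ring_scope.

(* Sequences indexed by the positive integers are indexed here by nat, so the
   j-th term stands for the mathematical (j+1)-st term; in particular a
   discrete distribution lives on nat instead of {1, 2, ...}.                *)

Section Laws.
Context d (Omega : measurableType d) (R : realType) (Pr : probability Omega R).
Context d' (T : measurableType d').

Definition sigma_of (I : Type) (J : set I) (X : I -> Omega -> T) :
    set (set Omega) :=
  <<s \bigcup_(i in J) preimage_set_system setT (X i) measurable >>.

Definition independent_classes (G H : set (set Omega)) : Prop :=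
  forall A B, G A -> H B -> Pr (A `&` B) = (Pr A * Pr B)%E.

(* Finite subfamilies other than initial segments are recovered by taking
   B i = setT for the remaining indices.                                     *)
Definition mutually_independent (X : nat -> Omega -> T) : Prop :=
  forall (m : nat) (B : nat -> set T), (forall i, measurable (B i)) ->
    Pr (\bigcap_(i in `I_m) X i @^-1` B i) =
    (\prod_(i < m) Pr (X i @^-1` B i))%E.

(* Given the sigma-algebra G, the variables X i (i < n) are i.i.d. with the
   random distribution mu: a version of the conditional probability of
   {X i \in B i for all i < n} given G is \prod_i mu (B i).  The defining
   identity of conditional probability is written out.                       *)
Definition conditionally_iid (G : set (set Omega)) (mu : Omega -> set T -> \bar R)
    (n : nat) (X : 'I_n -> Omega -> T) : Prop :=
  forall (A : set Omega) (B : 'I_n -> set T),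
    G A -> (forall i, measurable (B i)) ->
    Pr (A `&` \bigcap_(i in [set: 'I_n]) X i @^-1` B i) =
    (\int[Pr]_(w in A) \prod_(i < n) mu w (B i))%E.

Definition same_law d2 (Omega2 : measurableType d2) (Pr2 : probability Omega2 R)
    (X : Omega -> T) (X2 : Omega2 -> T) : Prop :=
  forall B : set T, measurable B -> Pr (X @^-1` B) = Pr2 (X2 @^-1` B).

End Laws.

Definition atomic (R : realType) (T : Type) (p : nat -> R) (x : nat -> T)
    (B : set T) : \bar R :=
  (\sum_(0 <= j <oo) (p j * \1_B (x j))%:E)%E.

Definition distinct_values (Omega : Type) (T : eqType) (n : nat)
    (X : 'I_n -> Omega -> T) (w : Omega) : nat :=
  size (undup [seq X i w | i <- enum 'I_n]).

Section RandomDiscreteDistribution.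
Context d (Omega : measurableType d) (R : realType) (Pr : probability Omega R).

Definition random_discrete_distribution (P : nat -> {RV Pr >-> R}) : Prop :=
  {ae Pr, forall w, (forall j, 0 <= P j w) /\
                    (\sum_(0 <= j <oo) (P j w)%:E = 1)%E}.

Definition iid_uniform (U : nat -> {RV Pr >-> R}) : Prop :=
  (forall j (B : set R), measurable B ->
     Pr (U j @^-1` B) = uniform_prob (@ltr01 R) B) /\
  mutually_independent Pr (fun j => U j : Omega -> R).

Definition independent_sequences (P U : nat -> {RV Pr >-> R}) : Prop :=
  independent_classes Pr (sigma_of [set: nat] (fun j => P j : Omega -> R))
                         (sigma_of [set: nat] (fun j => U j : Omega -> R)).

Definition uniform_marking (P U : nat -> {RV Pr >-> R}) : Prop :=
  [/\ random_discrete_distribution P, iid_uniform U & independent_sequences P U].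

(* F(v) = F_P[0, v]; the sum is finite almost surely.                        *)
Definition random_cdf (P U : nat -> {RV Pr >-> R}) (v : R) (w : Omega) : R :=
  fine (\sum_(0 <= j <oo) (P j w * (U j w <= v)%R%:R)%:E)%E.

Definition sample_from_P (P : nat -> {RV Pr >-> R}) (n : nat)
    (X : 'I_n -> {RV Pr >-> nat}) : Prop :=
  conditionally_iid Pr (sigma_of [set: nat] (fun j => P j : Omega -> R))
    (fun w => atomic (fun j => P j w) (fun j => j))
    (fun i => X i : Omega -> nat).

(* The distribution on [0, 1] with cumulative distribution function F is
   \sum_j P_j \delta_{U_j} (see random_cdfE below).                          *)
Definition sample_from_F (P U : nat -> {RV Pr >-> R}) (n : nat)
    (Y : 'I_n -> {RV Pr >-> R}) : Prop :=
  conditionally_iid Pr (sigma_of [set v : R | 0 <= v <= 1] (random_cdf P U))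
    (fun w => atomic (fun j => P j w) (fun j => U j w))
    (fun i => Y i : Omega -> R).

Definition distinct_count (P U : nat -> {RV Pr >-> R}) (n : nat)
    (K : Omega -> nat) : Prop :=
  (exists X : 'I_n -> {RV Pr >-> nat},
     sample_from_P P X /\
     K = distinct_values (fun i => X i : Omega -> nat)) \/
  (exists Y : 'I_n -> {RV Pr >-> R},
     sample_from_F P U Y /\
     K = distinct_values (fun i => Y i : Omega -> R)).

Local Open Scope ereal_scope.

(* The sum runs over sequences of k distinct indices, i.e. injections from
   'I_k; it has nonnegative terms.                                           *)
Definition partition_prob (P : nat -> {RV Pr >-> R}) (k : nat)
    (ns : 'I_k -> nat) : \bar R :=
  \esum_(j in [set j : {ffun 'I_k -> nat} | injective j])
    'E_Pr[(fun w => \prod_(i < k) (P (j i) w) ^+ ns i)%R].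

Definition ecpf (P : nat -> {RV Pr >-> R}) (k : nat) (ns : 'I_k -> nat) : \bar R :=
  ((k`!%:R)^-1 *
   ((\sum_(i < k) ns i)%N`!%:R / \prod_(i < k) ((ns i)`!%:R)))%R%:E *
  partition_prob P ns.

End RandomDiscreteDistribution.

Lemma random_cdfE d (Omega : measurableType d) (R : realType)
    (Pr : probability Omega R) (P U : nat -> {RV Pr >-> R}) (v : R) (w : Omega) :
  random_cdf P U v w =
  fine (atomic (fun j => P j w) (fun j => U j w) `]-oo, v]).
Proof.
rewrite /random_cdf /atomic; congr (fine (limn _)); apply/funext => m.
by apply: eq_bigr => j _; rewrite indicE mem_setE in_itv.
Qed.

Definition compositions (n k : nat) : {set {ffun 'I_k -> 'I_n.+1}} :=
  [set c : {ffun 'I_k -> 'I_n.+1} |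
    [forall i, (0 < c i)%N] && ((\sum_(i < k) c i)%N == n)]%SET.

(* Main.v *)
From HB Require Import structures.
Require Import Defs.
From mathcomp Require Import lra measurable_realfun.

(* Truncate P to its first m atoms and let q_m(k) be the expected mass of the
   samples of size n from these atoms that show exactly k distinct ones.
   Expanding (\sum_(j < m) P_j 1(U_j <= v))^n over the functions from 'I_n to
   'I_m, each term is a product of P's times v to the size of the image, by
   independence; so its mean is \sum_k q_m(k) v^k, and as m grows q_m(k)
   increases to the sum of the ECPF over compositions.  A sample satisfies
   Pr(K_n = k) >= q_m(k) for every m, and both sides sum to 1 over k in the
   limit, hence Pr(K_n = k) = lim q_m(k).  For samples from F this inequality is
   obtained on finite partitions that separate points in the limit, using that
   the U_j are almost surely distinct.  The equivalence of laws then combines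
   the identity of polynomials on [0, 1] with the uniqueness part of the
   Hausdorff moment problem, proved with the polynomials (1 - x^N)^M, which
   approximate the indicator of x < c when M ~ c^-N. *)

Set Implicit Arguments.
Unset Strict Implicit.
Unset Printing Implicit Defensive.

Local Open Scope classical_set_scope.
Local Open Scope ring_scope.

(** * Functions, fibers and compositions *)

(** Truncation keeps every expansion finite, so expectations and sums are exchanged by linearity
    alone and only the passage of m to infinity needs a convergence theorem. The constants of the
    ECPF come from writing a function with k values as an injection after a surjection: there are k!
    such factorizations, and a multinomial number of surjections with prescribed fiber sizes. The
    obstacle for samples from F is that the law of the sample is prescribed only on products of
    Borel sets, whereas the event K_n = k is in general not a finite union of such products. Once
    values are replaced by the cells of a finite partition, the event that exactly k cells are
    visited is such a union. Samples from P go through the same argument, with the constant atoms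
    x_j = j in place of U_j. In the moment problem the polynomials are controlled on either side of
    c but not at c. Hence rays with endpoints a < c < b are compared, and the gap between them is
    closed by continuity from below. *)

Section FunctionsWithGivenFibers.
Variable T : finType.

Let ffun_cons n (x : T * {ffun 'I_n -> T}) : {ffun 'I_n.+1 -> T} :=
  [ffun i => oapp x.2 x.1 (unlift ord0 i)].

Lemma big_ffun_recl (A : Type) (idx : A) (op : Monoid.com_law idx) n
    (F : {ffun 'I_n.+1 -> T} -> A) :
  \big[op/idx]_f F f =
  \big[op/idx]_a \big[op/idx]_f F (ffun_cons (a, f)).
Proof.
rewrite pair_big /= (reindex (@ffun_cons n)) /=; first by apply: eq_bigr => -[].
exists (fun f => (f ord0, [ffun i => f (lift ord0 i)])) => [[a f] _|f _].
  rewrite /ffun_cons ffunE unlift_none /=; congr (_, _).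
  by apply/ffunP => i; rewrite !ffunE liftK.
apply/ffunP => i; rewrite ffunE /=.
by case: unliftP => [j ->|->] //=; rewrite ffunE.
Qed.

Lemma card_ffun_fibers n (c : T -> nat) : (\sum_t c t = n)%N ->
  (#|[set s : {ffun 'I_n -> T} | [forall t, (\sum_i (s i == t))%N == c t]]%SET|
     * \prod_t (c t)`! = n`!)%N.
Proof.
elim: n c => [|n IHn] c sc.
  have c0 t : c t = 0%N.
    by apply/eqP; move/eqP: sc; rewrite sum_nat_eq0 => /forallP /(_ t).
  rewrite big1 ?muln1 => [|t _]; last by rewrite c0.
  rewrite (_ : finset _ = [set: _]%SET) ?cardsT ?card_ffun ?card_ord ?expn0//.
  apply/setP => s; rewrite !inE; apply/forallP => t.
  by rewrite big_ord0 c0.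
rewrite -sum1dep_card big_mkcond big_ffun_recl big_distrl/=.
transitivity ((\sum_t c t) * n`!)%N; last by rewrite sc factS.
rewrite big_distrl/=; apply: eq_bigr => a _.
rewrite -big_mkcond/= sum1dep_card.
have fibE f t : (\sum_i (ffun_cons (a, f) i == t) = (a == t) +
  \sum_(i < n) (f i == t))%N.
  rewrite big_ord_recl ffunE unlift_none; congr addn.
  by apply: eq_bigr => i _; rewrite ffunE liftK.
have [ca0|ca0] := posnP (c a).
  rewrite ca0 mul0n; apply/eqP; rewrite muln_eq0 cards_eq0; apply/orP; left.
  apply/eqP/setP => f; rewrite !inE; apply/negP => /forallP/(_ a).
  by rewrite fibE eqxx ca0.
pose c' t := (c t - (a == t))%N.
have cE t : c t = ((a == t) + c' t)%N.
  by rewrite /c' subnKC//; case: eqP => // <-.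
have sc' : (\sum_t c' t = n)%N.
  apply/eqP; rewrite -(eqn_add2l 1) [eqbRHS]add1n -sc (eq_bigr _ (fun t _ => cE t)).
  rewrite big_split/= eqn_add2r (bigD1 a)//= eqxx big1 ?addn0// => t.
  by rewrite eq_sym => /negPf ->.
rewrite -(IHn _ sc') mulnCA; congr muln.
  apply: eq_card => f; rewrite !inE; apply: eq_forallb => t.
  by rewrite fibE cE eqn_add2l.
rewrite (bigD1 a)//= [in RHS](bigD1 a)//= mulnA; congr muln.
  by rewrite cE eqxx add1n factS.
by apply: eq_bigr => t; rewrite eq_sym /c' => /negPf ->; rewrite subn0.
Qed.

End FunctionsWithGivenFibers.

(** Surjectivity is phrased through fiber sizes so that it becomes the positivity of the parts in
    [compositions]. *)
Definition surj_ffun n k (s : {ffun 'I_n -> 'I_k}) : bool :=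
  [forall l, (0 < \sum_i (s i == l))%N].

Lemma surj_ffunP n k (s : {ffun 'I_n -> 'I_k}) :
  reflect (forall l, exists i, s i = l) (surj_ffun s).
Proof.
apply: (iffP forallP) => H l; move: (H l).
  by rewrite lt0n sum_nat_eq0 negb_forall => /existsP[i];
    rewrite eqb0 negbK => /eqP; exists i.
by case=> i sil; rewrite (bigD1 i)//= sil eqxx.
Qed.

(** If g is injective, s surjective and g after s equals f, then g is a bijection from ['I_k] onto
    the image of f. So that image has k elements, there are k! choices of g, and each choice
    determines s. *)
Lemma card_factorizations n m k (f : {ffun 'I_n -> 'I_m}) :
  (\sum_(g : {ffun 'I_k -> 'I_m} | injectiveb g)
     \sum_(s : {ffun 'I_n -> 'I_k} | surj_ffun s) ([ffun i => g (s i)] == f) =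
   (#|f @: [set: 'I_n]%SET| == k) * k`!)%N.
Proof.
have [fk|fk] := eqVneq; last first.
  rewrite big1 // => g /injectiveP ginj; rewrite big1 // => s /surj_ffunP ss.
  apply/eqP; rewrite eqb0; apply: contraNN fk => /eqP <-.
  rewrite (_ : _ @: _ = g @: [set: _]%SET) ?card_imset ?cardsT ?card_ord//.
  apply/setP => x; apply/imsetP/imsetP => -[i _ ->].
    by exists (s i); rewrite ?ffunE.
  by have [j <-] := ss i; exists j; rewrite ?ffunE.
(* k! is read as the number of injections of ['I_k] into the k-element image of f, so both sides
   become sums over g. *)
rewrite mul1n -[RHS]ffactnn -[X in (X ^_ _)%N]fk -[X in (_ ^_ X)%N](card_ord k).
rewrite -(card_inj_ffuns_on 'I_k (mem (f @: [set: _]%SET))) -sum1dep_card.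
rewrite [RHS]big_mkcondl [LHS]big_mkcond [RHS]big_mkcond.
apply: eq_bigr => g _; case: ifP => [/injectiveP ginj|//].
case: ifP => [/ffun_onP gf|gf]; last first.
  rewrite big1 // => s /surj_ffunP ss; apply/eqP; rewrite eqb0.
  apply: contraFN gf => /eqP fE; apply/ffun_onP => l.
  have [i <-] := ss l; apply/imsetP; exists i => //; by rewrite -fE ffunE.
have imE : g @: [set: _]%SET = f @: [set: _]%SET.
  apply/eqP; rewrite eqEcard fk card_imset// cardsT card_ord leqnn andbT.
  by apply/fintype.subsetP => _ /imsetP[l _ ->]; exact: gf.
have /fin_all_exists[s sE] (i : 'I_n) : exists l, g l = f i.
  have : f i \in g @: [set: _]%SET by rewrite imE imset_f.
  by case/imsetP => l _ ->; exists l.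
rewrite (bigD1 (finfun s)) /=; last first.
  apply/surj_ffunP => l; have /imsetP[i _ gl] := gf l.
  by exists i; apply: ginj; rewrite ffunE sE.
rewrite (_ : _ == f); last by apply/eqP/ffunP => i; rewrite !ffunE.
rewrite big1// => s' /andP[_ s's]; apply/eqP; rewrite eqb0.
apply: contraNN s's => /eqP fE; apply/eqP/ffunP => i; apply: ginj;
  rewrite ffunE sE -fE ffunE //.
Qed.

(** After multiplication by k!, each f on the left is replaced by its factorizations g after s.
    Grouping the surjections s by their fiber sizes c makes the product depend on g and c only, and
    [card_ffun_fibers] counts the s in each group. *)
Lemma sum_prod_compositions (R : numFieldType) n m k (p : 'I_m -> R) :
  \sum_(f : {ffun 'I_n -> 'I_m} | #|f @: [set: 'I_n]%SET| == k) \prod_i p (f i) =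
  \sum_(c in compositions n k)
    k`!%:R^-1 * ((\sum_(i < k) c i)%N`!%:R / \prod_(i < k) (c i)`!%:R) *
    \sum_(g : {ffun 'I_k -> 'I_m} | injectiveb g) \prod_(l < k) p (g l) ^+ c l.
Proof.
have kN0 : k`!%:R != 0 :> R by rewrite pnatr_eq0 -lt0n fact_gt0.
(* [inord] loses nothing here: a fiber has at most n elements. *)
pose fib (s : {ffun 'I_n -> 'I_k}) : {ffun 'I_k -> 'I_n.+1} :=
  [ffun l => inord (\sum_i (s i == l))].
have fibE s l : fib s l = (\sum_i (s i == l))%N :> nat.
  rewrite ffunE inordK// ltnS -[leqRHS]card_ord -sum1_card.
  by apply: leq_sum => i _; exact: leq_b1.
have fibC s : surj_ffun s -> fib s \in compositions n k.
  move=> /forallP ss; rewrite inE; apply/andP; split.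
    by apply/forallP => l; rewrite fibE.
  rewrite (eq_bigr _ (fun l _ => fibE s l)) exchange_big/= -[eqbRHS]card_ord.
  rewrite -sum1_card; apply/eqP; apply: eq_bigr => i _.
  by rewrite (bigD1 (s i))//= eqxx big1 ?addn0// => l; rewrite eq_sym => /negPf ->.
apply: (mulfI kN0); rewrite mulr_sumr.
transitivity (\sum_(f : {ffun 'I_n -> 'I_m})
    \sum_(g : {ffun 'I_k -> 'I_m} | injectiveb g)
     \sum_(s : {ffun 'I_n -> 'I_k} | surj_ffun s) ([ffun i => g (s i)] == f)%:R *
       \prod_i p (f i)).
  rewrite big_mkcond; apply: eq_bigr => f _.
  transitivity ((\sum_(g : {ffun 'I_k -> 'I_m} | injectiveb g)
     \sum_(s : {ffun 'I_n -> 'I_k} | surj_ffun s) ([ffun i =>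
       g (s i)] == f))%N%:R * \prod_i p (f i)).
    by rewrite card_factorizations natrM; case: eqP; rewrite ?mul1r ?mul0r.
  by rewrite natr_sum mulr_suml; apply: eq_bigr => g _; rewrite natr_sum mulr_suml.
rewrite exchange_big/= mulr_sumr.
transitivity (\sum_(g : {ffun 'I_k -> 'I_m} | injectiveb g)
   \sum_(s : {ffun 'I_n -> 'I_k} | surj_ffun s) \prod_i p (g (s i))).
  apply: eq_bigr => g _; rewrite exchange_big; apply: eq_bigr => s _.
  rewrite (bigD1 [ffun i => g (s i)])//= eqxx mul1r [X in _ + X]big1 ?addr0.
    by apply: eq_bigr => i _; rewrite ffunE.
  by move=> f; rewrite eq_sym => /negPf ->; rewrite mul0r.
under [RHS]eq_bigr do rewrite !mulrA divff// mul1r mulr_sumr.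
rewrite [RHS]exchange_big/=; apply: eq_bigr => g _.
rewrite (partition_big _ _ fibC)/=; apply: eq_bigr => c Cc;
  have : c \in compositions n k by [].
rewrite inE => /andP[/forallP c0 /eqP cn].
have E s : (surj_ffun s && (fib s == c)) = [forall t, (\sum_i (s i == t))%N == c t].
  apply/andP/forallP => [[_ /eqP <-] t|H]; first by rewrite fibE.
  split; first by apply/forallP => t; rewrite (eqP (H t)).
  by apply/eqP/ffunP => t; apply/val_inj; rewrite /= fibE (eqP (H t)).
rewrite (eq_bigl _ _ E).
transitivity (\sum_(s : {ffun 'I_n -> 'I_k} | [forall t,
  (\sum_i (s i == t))%N == c t])
    \prod_(l < k) p (g l) ^+ c l).
  apply: eq_bigr => s /forallP H.
  rewrite (partition_big s predT)//=; apply: eq_bigr => l _.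
  rewrite (eq_bigr (fun=> p (g l))) => [|i /eqP ->//].
  rewrite prodr_const -(eqP (H l)) -sum1_card; congr (_ ^+ _).
  rewrite [LHS]big_mkcond.
  by apply: eq_bigr => i _; rewrite unfold_in -[eqn _ _]/(s i == l);
    case: (s i == l).
rewrite sumr_const -[LHS]mulr_natl; congr (_ * _).
have := card_ffun_fibers cn; rewrite cn => <-.
rewrite natrM -natr_prod mulfK ?cardsE//.
by rewrite pnatr_eq0 -lt0n prodn_gt0// => l; exact: fact_gt0.
Qed.

(** Subtracting one from every part is a bijection onto the sequences of k natural numbers with sum
    n - k, which [card_ord_partitions] counts. *)
Lemma card_compositions n k : (1 <= k <= n)%N ->
  #|compositions n k| = 'C(n.-1, k.-1).
Proof.
case: k => // k /andP[_ kn]; case: n kn => // n; rewrite ltnS => kn /=.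
rewrite -[in RHS](subnKC kn) -card_ord_partitions.
pose f (t : k.+1.-tuple 'I_(n - k).+1) : {ffun 'I_k.+1 -> 'I_n.+2} :=
  [ffun i => inord (tnth t i).+1].
have fE t i : f t i = (tnth t i).+1 :> nat.
  by rewrite ffunE inordK// ltnS (leq_trans (ltn_ord _))// ltnS leq_subr.
rewrite -(@card_in_imset _ _ f); last first.
  move=> t t' _ _ tt'; apply: eq_from_tnth => i; apply/val_inj/succn_inj.
  by rewrite -!fE tt'.
apply: eq_card => c; apply/idP/imsetP => [|[t]].
  rewrite inE => /andP[/forallP c0 /eqP cn].
  have cS i : c i = (c i).-1.+1 :> nat by rewrite prednK// c0.
  have sc : (\sum_i (c i).-1 = n - k)%N.
    apply/eqP; rewrite -(eqn_add2r k.+1) [eqbRHS]addnS subnK// -[eqbRHS]cn.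
    rewrite (eq_bigr _ (fun i _ => cS i)) -[X in _ == X](eq_bigr _ (fun i _ =>
      addn1 _)).
    by rewrite big_split/= sum_nat_const card_ord muln1.
  exists [tuple inord (c i).-1 | i < k.+1].
    rewrite inE big_tuple -[eqbRHS]sc; apply/eqP/eq_bigr => i _.
    by rewrite tnth_mktuple inordK// ltnS -sc (bigD1 i)//= leq_addr.
  apply/ffunP => i; apply/val_inj; rewrite /= fE tnth_mktuple inordK;
    first exact: cS.
  by rewrite ltnS -sc (bigD1 i)//= leq_addr.
rewrite inE big_tuple => /eqP st ->; rewrite inE; apply/andP; split.
  by apply/forallP => i; rewrite fE.
rewrite (eq_bigr _ (fun i _ => fE t i)).
rewrite -(eq_bigr _ (fun i _ => addn1 _)) big_split/= st sum_nat_const card_ord.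
by rewrite muln1 addnS subnK.
Qed.

(** * Sums over injections *)

Lemma subset_esum (R : realType) (T : choiceType) (A B : set T) (a : T -> \bar R) :
  A `<=` B -> (\esum_(i in A) a i <= \esum_(i in B) a i)%E.
Proof.
move=> AB; apply: ge_ereal_sup => _ [X [finX XA] <-].
by apply: ereal_sup_ubound; exists X => //; split => // x /XA /AB.
Qed.

Section EsumInjections.
Variables (R : realType) (k : nat) (a : {ffun 'I_k -> nat} -> \bar R).
Hypothesis a_ge0 : forall j, (0 <= a j)%E.

Let S m := [set j : {ffun 'I_k -> nat} | injective j /\ forall i, (j i < m)%N].

Let widen_ffun m (g : {ffun 'I_k -> 'I_m}) : {ffun 'I_k -> nat} := [ffun i =>
  val (g i)].

Lemma esum_bounded_injections m :
  (\sum_(g : {ffun 'I_k -> 'I_m} | injectiveb g) a [ffun i => val (g i)] =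
   \esum_(j in S m) a j)%E.
Proof.
pose r := [seq widen_ffun g | g <- enum [pred g : {ffun 'I_k -> 'I_m} | injectiveb
  g]].
have rS : [set` r] = S m.
  apply/seteqP; split => j /=; [move=> /mapP[g] | move=> [jinj jm]].
    rewrite mem_enum => /injectiveP ginj ->; split => [i i'|i]; rewrite !ffunE/=.
      by move/val_inj/ginj.
    exact: ltn_ord.
  apply/mapP; exists [ffun i => Ordinal (jm i)].
    rewrite mem_enum; apply/injectiveP => i i'; rewrite !ffunE => -[].
    exact: jinj.
  by apply/ffunP => i; rewrite !ffunE.
have ur : uniq r.
  rewrite map_inj_uniq ?enum_uniq// => g g' gg'; apply/ffunP => i; apply/val_inj.
  by have /ffunP/(_ i) := gg'; rewrite !ffunE.
transitivity (\sum_(j <- r) a j)%E; first by rewrite big_map big_enum.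
rewrite fsbig_seq// rS esum_fset//.
by rewrite -rS; exact: finite_seq.
Qed.

(** A finite set of injections has a common bound on its values, so the sum over all injections is
    the supremum of the sums over those with values below m, and these increase with m. *)
Lemma cvg_esum_injections :
  (\sum_(g : {ffun 'I_k -> 'I_m} | injectiveb g) a [ffun i => val (g i)])%E
    @[m --> \oo] --> (\esum_(j in [set j : {ffun 'I_k -> nat} | injective j]) a
      j)%E.
Proof.
under eq_fun do rewrite esum_bounded_injections.
suff -> : (\esum_(j in [set j : {ffun 'I_k -> nat} | injective j]) a j)%E =
    ereal_sup (range (fun m => \esum_(j in S m) a j)%E).
  apply: ereal_nondecreasing_cvgn => m m' mm'; apply: subset_esum => j [jinj jm].
  by split => // i; exact: leq_trans (jm i) mm'.
apply/le_anti/andP; split; last first.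
  by apply: ge_ereal_sup => _ [m _ <-]; apply: subset_esum => j [].
apply: ge_ereal_sup => _ [X [finX Xinj] <-].
(* The largest value taken by any function in the finite set X, so that X lies in [S M.+1]. *)
pose M := \max_(j <- finmap.enum_fset (fset_set X)) \max_(i < k) j i.
apply: (@le_trans _ _ (\esum_(j in S M.+1) a j)%E); last first.
  by apply: ereal_sup_ubound; exists M.+1.
apply: esum_ge; exists X => //; split => // j Xj; split; first exact: Xinj.
move=> i; rewrite ltnS; apply: (@leq_trans (\max_(i < k) j i)).
  exact: (leq_bigmax i).
apply: (leq_bigmax_seq (F := fun j : {ffun 'I_k -> nat} => \max_(i < k) j i) j) =>
  //.
by have := in_fset_set finX j; rewrite (mem_set Xj).
Qed.

End EsumInjections.

(** * Uniqueness in the Hausdorff moment problem *)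

Section StepPolynomials.
Variable R : realType.
Implicit Types a b c x : R.

Lemma bernoulli_ge x m : 0 <= x <= 1 -> 1 - x *+ m <= (1 - x) ^+ m.
Proof.
move=> /andP[x0 x1]; elim: m => [|m IHm]; first by rewrite mulr0n subr0.
rewrite exprS; apply: le_trans (_ : (1 - x) * (1 - x *+ m) <= _).
  have : 0 <= x * (x *+ m) by rewrite mulr_ge0// mulrn_wge0.
  by rewrite mulrSr; nra.
by rewrite ler_wpM2l// subr_ge0.
Qed.

(** The upper companion of Bernoulli's inequality. A decay of order 1 / (m x) is all that
    [step_poly_right] requires, so no exponential enters. *)
Lemma bernoulli_le x m : 0 <= x <= 1 -> (1 - x) ^+ m * (1 + x *+ m) <= 1.
Proof.
move=> /andP[x0 x1]; elim: m => [|m IHm]; first by rewrite mulr0n addr0 mulr1.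
apply: le_trans IHm; rewrite exprSr -mulrA ler_wpM2l ?exprn_ge0 ?subr_ge0//.
have : 0 <= x * (x *+ m) by rewrite mulr_ge0// mulrn_wge0.
have := sqr_ge0 x; rewrite mulrSr expr2; nra.
Qed.

(* The exponent is about c^-N, so its product with x^N tends to 0 for x < c and
   to infinity for x > c. *)
Definition step_poly c N : {poly R} := (1 - 'X^N) ^+ Num.truncn (c ^- N).

Lemma step_polyE c N x : (step_poly c N).[x] = (1 - x ^+ N) ^+ Num.truncn (c ^- N).
Proof. by rewrite horner_exp !hornerE. Qed.

Lemma step_poly_ge0 c N x : 0 <= x <= 1 -> 0 <= (step_poly c N).[x].
Proof.
by move=> /andP[x0 x1]; rewrite step_polyE exprn_ge0// subr_ge0 exprn_ile1.
Qed.

Lemma step_poly_le1 c N x : 0 <= x <= 1 -> (step_poly c N).[x] <= 1.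
Proof.
move=> /andP[x0 x1]; rewrite step_polyE exprn_ile1 ?subr_ge0 ?exprn_ile1//.
by rewrite gerBl exprn_ge0.
Qed.

Lemma step_poly_left a c N x : 0 < c -> 0 <= x <= a -> x <= 1 ->
  1 - (a / c) ^+ N <= (step_poly c N).[x].
Proof.
move=> c0 /andP[x0 xa] x1; rewrite step_polyE.
apply: le_trans (bernoulli_ge _ _); last by rewrite exprn_ge0//= exprn_ile1.
rewrite lerD2l lerN2 -mulr_natr expr_div_n ler_pM ?exprn_ge0 ?lerXn2r ?nnegrE//.
  exact: le_trans xa.
by rewrite truncn_le// invr_ge0 exprn_ge0// ltW.
Qed.

(** By [bernoulli_le] the value is at most 1 / (1 + m x^N). Truncation makes m smaller than c^-N by
    less than one; as x^N <= 1, the summand 1 absorbs this loss and the denominator is at least (b /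
    c)^N. *)
Lemma step_poly_right b c N x : 0 < c -> 0 < b <= x -> x <= 1 ->
  (step_poly c N).[x] <= (c / b) ^+ N.
Proof.
move=> c0 /andP[b0 bx] x1; have x0 : 0 < x by exact: lt_le_trans bx.
have xN01 : 0 <= x ^+ N <= 1 by rewrite exprn_ge0 ?exprn_ile1// ltW.
rewrite step_polyE; set m := Num.truncn _.
have m_gt : c ^- N - 1 < m%:R by rewrite ltrBlDr natr1 truncnS_gt.
have bc0 : 0 < (b / c) ^+ N by rewrite exprn_gt0// divr_gt0.
have : (b / c) ^+ N <= 1 + x ^+ N *+ m.
  apply: le_trans (_ : x ^+ N * c ^- N <= _).
    rewrite expr_div_n ler_pM2r ?invr_gt0 ?exprn_gt0//.
    by rewrite lerXn2r ?nnegrE// ltW.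
  by rewrite -mulr_natr; case/andP: xN01 => *; nra.
move=> le1; rewrite -[c / b]invf_div exprVn -[leRHS]mul1r ler_pdivlMr//.
apply: le_trans (bernoulli_le m xN01); rewrite ler_wpM2l// exprn_ge0// subr_ge0.
by case/andP: xN01.
Qed.

End StepPolynomials.

Section MomentProblem.
Variable R : realType.
Local Notation D := (`[0 : R, 1]%classic).

Lemma bounded_itv01_integrable (mu : probability R R) (f : R -> R) (M : R) :
  measurable_fun setT f -> (forall x, 0 <= x <= 1 -> `|f x| <= M) ->
  mu.-integrable D (EFin \o f).
Proof.
move=> mf fM; apply: measurable_bounded_integrable => //.
- by rewrite (le_lt_trans (probability_le1 _ _)) ?ltry.
- exact: measurable_funTS.
- exists M; split; first exact: num_real.
  move=> t Mt x /=; rewrite in_itv/= => x01; exact: le_trans (fM _ x01) (ltW Mt).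
Qed.

Lemma measurable_horner (p : {poly R}) : measurable_fun setT (horner p).
Proof. by apply: continuous_measurable_fun; exact: continuous_horner. Qed.

Lemma integrable_horner01 (mu : probability R R) (p : {poly R}) :
  mu.-integrable D (EFin \o horner p).
Proof.
apply: (@bounded_itv01_integrable _ _ (\sum_(i < size p) `|p`_i|)).
  exact: measurable_horner.
move=> x /andP[x0 x1]; rewrite horner_coef (le_trans (ler_norm_sum _ _ _))//.
apply: ler_sum => i _; rewrite normrM ler_piMr// ger0_norm ?exprn_ge0//.
exact: exprn_ile1.
Qed.

Lemma Rintegral_horner01 (mu : probability R R) (p : {poly R}) :
  (\int[mu]_(x in D) p.[x] = \sum_(i < size p) p`_i * \int[mu]_(x in D) x ^+ i)%R.
Proof.
have intX (c : R) n : mu.-integrable D (EFin \o (fun x => c * x ^+ n)).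
  rewrite [X in EFin \o X](_ : _ = horner (c *: 'X^n)).
    exact: integrable_horner01.
  by apply/funext => x; rewrite hornerZ hornerXn.
have intX1 n : mu.-integrable D (EFin \o (fun x => x ^+ n)).
  rewrite (_ : (fun x => x ^+ n) = (fun x => 1 * x ^+ n)) ?intX//.
  by apply/funext => x; rewrite mul1r.
rewrite /Rintegral (eq_integral (fun x : R =>
  \sum_(i < size p) (p`_i * x ^+ i)%:E)%E).
  rewrite (integral_sum _ (fun i : 'I_(size p) => intX p`_i i))//.
  rewrite -sum_fine => [|i _]; last exact: integrable_fin_num (intX _ _).
  apply: eq_bigr => i _; exact: (RintegralZl _ _ (intX1 i)).
by move=> x _; rewrite horner_coef sumEFin.
Qed.

Lemma probability_setI1 (mu : probability R R) (A : set R) : mu D = 1%E ->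
  measurable A -> mu (A `&` D) = mu A.
Proof.
move=> mu1 mA; rewrite [RHS](measureDI _ mA (measurable_itv `[0, 1]))/=.
rewrite [X in (X + _)%E](_ : _ = 0%E) ?add0e//.
have m0 : mu (~` D) = 0%E by rewrite probability_setC// mu1 subee.
by apply: (subset_measure0 _ _ _ m0) => //;
  [exact: measurableD | exact: measurableC].
Qed.

(** With c the midpoint of a and b and s the N-th step polynomial, on [0, 1] one has (1 - (a/c)^N)
    1(x < a) <= s(x) <= 1(x < b) + (c/b)^N. The integral of s is the same under both measures
    because it involves moments only; then N tends to infinity. *)
Lemma moments_le (mu1 mu2 : probability R R) (a b : R) : 0 < a < b ->
  mu1 D = 1%E -> mu2 D = 1%E ->
  (forall n, \int[mu1]_(x in D) x ^+ n = \int[mu2]_(x in D) x ^+ n)%R ->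
  (mu1 `]-oo, a[%classic <= mu2 `]-oo, b[%classic)%E.
Proof.
move=> /andP[a0 ab] D1 D2 m12; pose c := (a + b) / 2.
have ac : a < c by rewrite midf_lt.
have cb : c < b by rewrite midf_lt.
have c0 : 0 < c by exact: lt_trans ac.
have b0 : 0 < b by exact: lt_trans cb.
have indE (mu : probability R R) x : mu D = 1%E ->
    (\int[mu]_(t in D) \1_(`]-oo, x[%classic) t = fine (mu `]-oo, x[%classic))%R.
  move=> ?; rewrite /Rintegral integral_indic//; congr fine.
  exact: probability_setI1. 
have indI (mu : probability R R) x : mu.-integrable D (EFin \o \1_(`]-oo,
  x[%classic)).
  apply: (@bounded_itv01_integrable _ _ 1); first exact: measurable_indic.
  by move=> t _; rewrite indicE; case: (_ \in _); rewrite ?normr1 ?normr0.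
have cstI (mu : probability R R) r : mu.-integrable D (EFin \o cst r).
  by apply: (@bounded_itv01_integrable _ _ `|r|).
pose m1 := fine (mu1 `]-oo, a[%classic); pose m2 := fine (mu2 `]-oo, b[%classic).
have le12 N : (1 - (a / c) ^+ N) * m1 <= m2 + (c / b) ^+ N.
  apply: (@le_trans _ _ (\int[mu1]_(x in D) (step_poly c N).[x])%R).
    rewrite /m1 -indE// -RintegralZl//; last exact: indI.
    apply: le_Rintegral => //.
    - exact: (integrableZl _ (1 - (a / c) ^+ N) (indI mu1 a)).
    - exact: integrable_horner01.
    move=> x /=; rewrite in_itv/= => /andP[x0 x1]; rewrite indicE.
    have [|_] := boolP (_ \in _); last by rewrite mulr0 step_poly_ge0 ?x0.
    rewrite inE/= in_itv/= mulr1 => xa.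
    by apply: step_poly_left => //; rewrite x0 ltW.
  rewrite Rintegral_horner01; under eq_bigr do rewrite m12.
  rewrite -Rintegral_horner01.
  apply: (@le_trans _ _ (\int[mu2]_(x in D) (\1_(`]-oo, b[%classic) x +
    (c / b) ^+ N))%R).
    apply: le_Rintegral => //; first exact: integrable_horner01.
      exact: (integrableD _ (indI mu2 b) (cstI mu2 ((c / b) ^+ N))).
    move=> x /=; rewrite in_itv/= => /andP[x0 x1]; rewrite indicE.
    have [_|] := boolP (_ \in _).
      by rewrite ler_wpDr ?step_poly_le1 ?x0// exprn_ge0// divr_ge0 ?ltW.
    rewrite notin_setE/= in_itv/= => /negP; rewrite -leNgt add0r => bx.
    by apply: step_poly_right => //; rewrite b0.
  rewrite RintegralD//; [|exact: indI|exact: cstI].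
  by rewrite Rintegral_cst// -[fine (_ D)]/(fine (mu2 D)) D2 mulr1 indE.
rewrite -[leLHS]fineK ?fin_num_measure// -[leRHS]fineK ?fin_num_measure//.
rewrite lee_fin -/m1 -/m2.
have cf : (fun N => (1 - (a / c) ^+ N) * m1) @ \oo --> (1 - 0) * m1.
  apply: cvgMl; apply: cvgB; [exact: cvg_cst|apply: cvg_expr].
  by rewrite ger0_norm ?ltr_pdivrMr ?mul1r// divr_ge0 ?ltW.
have cg : (fun N => m2 + (c / b) ^+ N) @ \oo --> m2 + 0.
  apply: cvgD; [exact: cvg_cst|apply: cvg_expr].
  rewrite ger0_norm; last by rewrite divr_ge0 ?ltW.
  by rewrite ltr_pdivrMr // mul1r.
have := ler_cvg_to cf cg; rewrite subr0 mul1r addr0; apply.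
exact: nearW.
Qed.

(** [moments_le] applies between a - 1/(n+1) and a. The shorter rays increase to the open ray at a,
    so continuity from below gives the same endpoint on both sides even if there is an atom at a. *)
Lemma moments_ray_le (mu1 mu2 : probability R R) (a : R) :
  mu1 D = 1%E -> mu2 D = 1%E ->
  (forall n, \int[mu1]_(x in D) x ^+ n = \int[mu2]_(x in D) x ^+ n)%R ->
  (mu1 `]-oo, a[%classic <= mu2 `]-oo, a[%classic)%E.
Proof.
move=> D1 D2 m12; pose F (n : nat) : set R := `]-oo, a - n.+1%:R^-1[%classic.
have UF : \bigcup_n F n = `]-oo, a[%classic.
  apply/seteqP; split => [x [n _]|x] /=; rewrite !in_itv/=.
    by move=> /lt_trans; apply; rewrite ltrBlDr ltrDl invr_gt0.
  rewrite -subr_gt0 => xa; exists (Num.truncn (a - x)^-1) => //=.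
  by rewrite /F/= in_itv/= ltrBrDr -ltrBrDl invf_plt ?posrE// truncnS_gt.
have : mu1 \o F @ \oo --> mu1 (\bigcup_n F n).
  apply: nondecreasing_cvg_mu; [by move=> n; exact: measurable_itv|by rewrite UF;
    exact: measurable_itv|].
  move=> m n mn; apply/subsetPset => x; rewrite /F/= !in_itv/= => /lt_le_trans;
    apply.
  by rewrite lerD2l lerN2 lef_pV2 ?posrE ?ler_nat.
rewrite UF => /cvg_lim <-//; apply: lime_le.
  apply: ereal_nondecreasing_is_cvgn => m n mn; rewrite /= le_measure ?inE//;
    [exact: measurable_itv|exact: measurable_itv|].
  move=> x; rewrite /F/= !in_itv/= => /lt_le_trans; apply.
  by rewrite lerD2l lerN2 lef_pV2 ?posrE ?ler_nat.
apply: nearW => n /=; have [a0|a0] := ltP 0 (a - n.+1%:R^-1).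
  by apply: moments_le => //; rewrite a0/= ltrBlDr ltrDl invr_gt0.
(* The endpoint is now at most 0, so the ray misses [0, 1], which carries all the mass of [mu1]. *)
rewrite -(probability_setI1 D1) ?/F/=; last exact: measurable_itv.
rewrite (_ : _ `&` _ = set0) ?measure0//.
apply/seteqP; split => // x [] /=; rewrite !in_itv/= => xa /andP[x0 _].
by have := lt_le_trans xa a0; rewrite ltNge x0.
Qed.

(** Open rays are stable under intersection and generate the Borel sets; on them the measures agree
    by [moments_ray_le] used in both directions. *)
Lemma moments_unique (mu1 mu2 : probability R R) (B : set R) :
  mu1 D = 1%E -> mu2 D = 1%E ->
  (forall n, \int[mu1]_(x in D) x ^+ n = \int[mu2]_(x in D) x ^+ n)%R ->
  measurable B -> mu1 B = mu2 B.
Proof.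
move=> D1 D2 m12; apply: (@measure_unique _ R R (@RGenInftyO.G R) (fun n => `]-oo,
  n%:R[%classic) _ _ _ _ mu1 mu2).
- exact: RGenInftyO.measurableE.
- move=> _ _ [x ->] [y ->]; exists (Num.min x y); apply/seteqP.
  split=> t /=; rewrite !in_itv/= lt_min; last by move=> /andP[].
  by move=> [-> ->].
- by move=> n; exists n%:R.
- apply/seteqP; split => // x _; exists (Num.truncn x).+1 => //=.
  by rewrite in_itv/= truncnS_gt.
- move=> _ [x ->]; apply/le_anti/andP; split; first exact: moments_ray_le.
  by apply: moments_ray_le => // n; exact/esym/m12.
- by move=> n; rewrite (le_lt_trans (probability_le1 _ _)) ?ltry.
Qed.

End MomentProblem.

(** * Measurability of limits *)

Section MeasurabilityOfLimits.
Context d (T : measurableType d) (R : realType).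
Local Open Scope ereal_scope.

Lemma limn_einf_esup_cvg (u : (\bar R)^nat) : limn_einf u = limn_esup u ->
  cvgn u.
Proof.
move=> uu; apply/cvg_ex; exists (limn_esup u).
apply: (@squeeze_cvge _ _ _ _ (einfs u) _ (esups u)).
- apply: nearW => n; apply/andP; split.
  + by apply: ereal_inf_lbound; exists n => /=.
  + by apply: ereal_sup_ubound; exists n => /=.
- rewrite -uu limn_einf_lim; exact: is_cvg_einfs.
- rewrite limn_esup_lim; exact: is_cvg_esups.
Qed.

(* No convergence is assumed: the series defining random_cdf and atomic may
   diverge on a null set, where limn takes a default value. *)
Lemma measurable_fun_limn (f : (T -> \bar R)^nat) :
  (forall n, measurable_fun setT (f n)) ->
  measurable_fun setT (fun x => limn (f ^~ x)).
Proof.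
move=> mf; pose sup x := limn_esup (f ^~ x); pose inf x := limn_einf (f ^~ x).
have msup : measurable_fun setT sup by exact: measurable_fun_limn_esup.
have minf : measurable_fun setT inf.
  rewrite (_ : inf = fun x => - limn_esup (fun n => - f n x)).
    apply: measurableT_comp => //; apply: measurable_fun_limn_esup => n.
    exact: measurableT_comp.
  by apply/funext => x; rewrite -limn_einfN; congr limn_einf; apply/funext => n /=;
    rewrite oppeK.
(* The sequence converges exactly where its upper limit is at most its lower limit; elsewhere [limn]
   returns [point]. *)
rewrite (_ : (fun _ => _) = fun x => if sup x <= inf x then sup x else point).
  apply: measurable_fun_ifT => //.
  apply: measurable_fun_lee => //.
apply/funext => x; case: ifPn => [si|].
  rewrite /sup is_cvg_limn_esupE//; apply: limn_einf_esup_cvg.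
  by apply/le_anti; rewrite limn_einf_sup.
move=> sNi; apply: getPN => l fl; move/negP: sNi; apply.
by rewrite /sup /inf; have [-> ->] := cvg_limn_einf_sup fl.
Qed.

End MeasurabilityOfLimits.

Section RandomDistributionFunction.
Context d (Omega : measurableType d) (R : realType) (Pr : probability Omega R).

Lemma measurable_atomic d' (T : measurableType d') (P : nat -> {RV Pr >-> R})
    (x : nat -> Omega -> T) (B : set T) :
  (forall j, measurable_fun setT (x j)) -> measurable B ->
  measurable_fun setT (fun w => atomic (fun j => P j w) (fun j => x j w) B).
Proof.
move=> mx mB; apply: measurable_fun_limn => n.
apply: emeasurable_sum => j; apply/measurable_EFinP.
apply: measurable_funM => //.
by apply: measurableT_comp (mx j); exact: measurable_indic.
Qed.

Lemma measurable_random_cdf (P U : nat -> {RV Pr >-> R}) v :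
  measurable_fun setT (random_cdf P U v).
Proof.
rewrite (_ : random_cdf P U v =
    fine \o (fun w => atomic (fun j => P j w) (fun j => U j w) `]-oo, v])).
  apply: measurableT_comp; first exact: fine_measurable.
  exact: measurable_atomic.
by apply/funext => w; exact: random_cdfE.
Qed.

End RandomDistributionFunction.

(** * Integration of functions bounded on an event of probability one *)

Section IntegrationOfBoundedFunctions.
Context d (Omega : measurableType d) (R : realType) (Pr : probability Omega R).
Variable D : set Omega.
Hypotheses (mD : measurable D) (DC0 : Pr (~` D) = 0%E).

(** Measurability is global but the bound is asked on D only, since the weights are controlled only
    there. The class is stable under sums and products and ensures integrability over D. *)
Definition bounded_meas (f : Omega -> R) : Prop :=
  measurable_fun setT f /\ exists M, forall w, D w -> `|f w| <= M.

Lemma bounded_meas_integrable f : bounded_meas f -> Pr.-integrable D (EFin \o f).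
Proof.
move=> [mf [M fM]]; apply: measurable_bounded_integrable => //.
- by rewrite (le_lt_trans (probability_le1 _ _)) ?ltry.
- exact: measurable_funTS.
- exists M; split; first exact: num_real.
  by move=> t Mt w Dw /=; exact: le_trans (fM _ Dw) (ltW Mt).
Qed.

Lemma bounded_meas_cst c : bounded_meas (cst c).
Proof. by split => //; exists `|c|. Qed.

Lemma bounded_measM f g :
  bounded_meas f -> bounded_meas g -> bounded_meas (fun w => f w * g w).
Proof.
move=> [mf [M fM]] [mg [N gN]]; split; first exact: measurable_funM.
by exists (M * N) => w Dw; rewrite normrM ler_pM ?fM ?gN.
Qed.

Lemma bounded_measD f g :
  bounded_meas f -> bounded_meas g -> bounded_meas (fun w => f w + g w).
Proof.
move=> [mf [M fM]] [mg [N gN]]; split; first exact: measurable_funD.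
by exists (M + N) => w Dw; rewrite (le_trans (ler_normD _ _))// lerD ?fM ?gN.
Qed.

Lemma bounded_meas_sum (I : Type) (r : seq I) (A : pred I) (h : I -> Omega -> R) :
  (forall i, bounded_meas (h i)) -> bounded_meas (fun w =>
    \sum_(i <- r | A i) h i w).
Proof.
move=> hb; elim: r => [|i r IHr].
  by under eq_fun do rewrite big_nil; exact: bounded_meas_cst.
under eq_fun do rewrite big_cons.
by case: (A i) => //; exact: bounded_measD.
Qed.

Lemma bounded_meas_prod (I : Type) (r : seq I) (h : I -> Omega -> R) :
  (forall i, bounded_meas (h i)) -> bounded_meas (fun w => \prod_(i <- r) h i w).
Proof.
move=> hb; elim: r => [|i r IHr].
  by under eq_fun do rewrite big_nil; exact: bounded_meas_cst.
by under eq_fun do rewrite big_cons; exact: bounded_measM.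
Qed.

Lemma bounded_measX n f : bounded_meas f -> bounded_meas (fun w => f w ^+ n).
Proof.
move=> fb; elim: n => [|n IHn]; first exact: bounded_meas_cst.
by under eq_fun do rewrite exprS; exact: bounded_measM.
Qed.

Lemma bounded_measN f : bounded_meas f -> bounded_meas (fun w => - f w).
Proof.
move=> [mf [M fM]]; split; first exact: measurableT_comp.
by exists M => w Dw; rewrite normrN fM.
Qed.

Lemma bounded_meas_norm f : bounded_meas f -> bounded_meas (fun w => `|f w|).
Proof.
move=> [mf [M fM]]; split; first exact: measurableT_comp.
by exists M => w Dw; rewrite normr_id fM.
Qed.

Lemma bounded_meas_indic (B : set Omega) : measurable B -> bounded_meas \1_B.
Proof.
move=> mB; split; first exact: measurable_indic.
by exists 1 => w _; rewrite indicE; case: (_ \in _); rewrite ?normr1 ?normr0.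
Qed.

Lemma Rintegral_bsum (I : Type) (r : seq I) (A : pred I) (h : I -> Omega -> R) :
  (forall i, bounded_meas (h i)) ->
  (\int[Pr]_(w in D) (\sum_(i <- r | A i) h i w) =
   \sum_(i <- r | A i) \int[Pr]_(w in D) h i w)%R.
Proof.
move=> hb; elim: r => [|i r IHr].
  under eq_Rintegral do rewrite big_nil.
  by rewrite big_nil Rintegral_cst// mul0r.
rewrite big_cons -IHr; under eq_Rintegral do rewrite big_cons.
case: (A i) => //; rewrite RintegralD//; apply: bounded_meas_integrable => //.
exact: bounded_meas_sum.
Qed.

Lemma full_measure : Pr D = 1%E.
Proof.
have := probability_setC Pr mD; rewrite DC0 => /esym/eqP.
by rewrite sube_eq ?fin_num_adde_defr// add0e => /eqP.
Qed.

Lemma integral_fullE (f : Omega -> \bar R) : measurable_fun setT f ->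
  (\int[Pr]_w f w = \int[Pr]_(w in D) f w)%E.
Proof.
move=> mf; rewrite [RHS]integral_mkcond; apply: ae_eq_integral => //.
  by apply/(measurable_restrictT _ mD); exact: measurable_funTS.
exists (~` D); split => //; first exact: measurableC.
by move=> w /=; apply: contra_not => Dw _; rewrite patchE mem_set.
Qed.

Lemma Rintegral_fullE f : bounded_meas f ->
  (\int[Pr]_w (f w)%:E = (\int[Pr]_(w in D) f w)%R%:E)%E.
Proof.
move=> fb; rewrite /Rintegral fineK; last first.
  by apply: integrable_fin_num => //; exact: bounded_meas_integrable.
by apply: integral_fullE; apply/measurable_EFinP; case: fb.
Qed.

Lemma expectation_fullE f : bounded_meas f ->
  ('E_Pr[f] = (\int[Pr]_(w in D) f w)%R%:E)%E.
Proof. by move=> fb; rewrite unlock Rintegral_fullE. Qed.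

Lemma Rintegral_indicE B : measurable B ->
  (\int[Pr]_(w in D) \1_B w)%R = fine (Pr B).
Proof.
move=> mB; apply: EFin_inj; rewrite -Rintegral_fullE;
  last exact: bounded_meas_indic.
by rewrite integral_indic// setIT fineK// fin_num_measure.
Qed.

Lemma bounded_convergence (f_ : nat -> Omega -> R) (f : Omega -> R) (M : R) :
  (forall m, measurable_fun setT (f_ m)) -> measurable_fun setT f ->
  (forall m w, D w -> `|f_ m w| <= M) ->
  (forall w, D w -> f_ ^~ w @ \oo --> f w) ->
  (\int[Pr]_(w in D) f_ m w)%R @[m --> \oo] --> (\int[Pr]_(w in D) f w)%R.
Proof.
move=> mf_ mf fM ff.
have [] := @dominated_convergence _ _ _ Pr D mD (fun m => EFin \o f_ m)
  (EFin \o f) (cst M%:E).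
- by move=> m; apply/measurable_EFinP; exact: measurable_funTS.
- by apply/measurable_EFinP; exact: measurable_funTS.
- by apply: aeW => w Dw; apply/fine_cvgP; split; [exact: nearW|exact: ff].
- exact: (bounded_meas_integrable (bounded_meas_cst M)).
- by apply: aeW => w m Dw; rewrite lee_fin fM.
by move=> fI _; rewrite -(fineK (integrable_fin_num mD fI)) => /fine_cvg.
Qed.

End IntegrationOfBoundedFunctions.

(** * Independence of the weights and the marks *)

Section Independence.
Context d (Omega : measurableType d) (R : realType) (Pr : probability Omega R).

(* Layer cake: E[Z; B] is the integral over t >= 0 of Pr(Z > t, B). *)
Lemma expectation_indep (Z : Omega -> R) (B : set Omega) :
  measurable_fun setT Z -> (forall w, 0 <= Z w) -> measurable B ->
  (forall C : set R, measurable C ->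
     Pr (Z @^-1` C `&` B) = (Pr (Z @^-1` C) * Pr B)%E) ->
  (\int[Pr]_w (Z w * \1_B w)%:E = Pr B * \int[Pr]_w (Z w)%:E)%E.
Proof.
move=> mZ Z0 mB ZB.
have mZB : measurable_fun setT (fun w => Z w * \1_B w).
  by apply: measurable_funM => //; exact: measurable_indic.
pose X : {RV Pr >-> R} := HB.pack Z (isMeasurableFun.Build _ _ _ _ Z mZ).
pose Y : {RV Pr >-> R} := HB.pack (fun w =>
  Z w * \1_B w) (isMeasurableFun.Build _ _ _ _ _ mZB).
have := @ge0_expectation_ccdf _ _ _ Pr X Z0; rewrite unlock => ->.
have /(@ge0_expectation_ccdf _ _ _ Pr) : forall w, 0 <= Y w.
  by move=> w; rewrite /= mulr_ge0// indicE.
rewrite unlock => ->; rewrite -ge0_integralZl//; last first.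
  by apply: measurable_funTS; exact: ccdf_measurable.
apply: eq_integral => t; rewrite inE/= in_itv/= andbT => t0.
(* As t >= 0, the product of Z and the indicator of B exceeds t exactly when Z does and the point
   lies in B. *)
rewrite /ccdf /distribution /pushforward muleC -ZB//; congr (Pr _).
apply/seteqP; split => [w|w [+ Bw]]; rewrite /= !in_itv/= !andbT indicE.
  have [Bw|Bw] := boolP (w \in B); first by rewrite mulr1; split => //;
    exact: set_mem.
  by rewrite mulr0 ltNge t0.
by rewrite mem_set// mulr1.
Qed.

Variables P U : nat -> {RV Pr >-> R}.

Let sigmaP := sigma_of [set: nat] (fun j => P j : Omega -> R).

Lemma sigma_of_preimage d' (T : measurableType d') (X : nat -> Omega -> T) j (C :
  set T) :
  measurable C -> sigma_of [set: nat] X (X j @^-1` C).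
Proof.
move=> mC; apply: sub_sigma_algebra; exists j => //.
by exists C => //; rewrite setTI.
Qed.

Lemma sigma_of_prod n (f : 'I_n -> nat) (C : set R) : measurable C ->
  sigmaP ((fun w => `|\prod_i P (f i) w|) @^-1` C).
Proof.
move=> mC.
(* With the generated sigma-algebra taken as that of the source space, membership in it follows from
   the usual closure properties of measurable functions. *)
pose G := \bigcup_(i in [set: nat]) preimage_set_system setT (P i : Omega -> R)
  measurable.
have mP j : @measurable_fun _ _ (g_sigma_algebraType G) R setT (P j : Omega -> R).
  by move=> _ B mB; rewrite setTI; exact: sigma_of_preimage.
have : @measurable_fun _ _ (g_sigma_algebraType G) R setT (fun w =>
  `|\prod_i P (f i) w|).
  apply: measurableT_comp => //; apply: measurable_prod => i _; exact: mP.
by move=> /(_ measurableT C mC); rewrite setTI.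
Qed.

Lemma sigma_of_bigcap (X : nat -> Omega -> R) m (B : nat -> set R) :
  (forall i, measurable (B i)) ->
  sigma_of [set: nat] X (\bigcap_(i in `I_m) X i @^-1` B i).
Proof.
move=> mB; pose G := \bigcup_(i in [set: nat]) preimage_set_system setT (X i)
  measurable.
rewrite -[sigma_of _ _]/(@measurable _ (g_sigma_algebraType G)).
apply: fin_bigcap_measurable => // i _; exact: sigma_of_preimage.
Qed.

Lemma measurable_bigcap_preimage (X : nat -> {RV Pr >-> R}) m (B : nat -> set R) :
  (forall i, measurable (B i)) -> measurable (\bigcap_(i in `I_m) X i @^-1` B i).
Proof.
move=> mB; apply: fin_bigcap_measurable => // i _.
by rewrite -[X in measurable X]setTI; exact: measurable_funP.
Qed.

Lemma measurable_prod_RV n (f : 'I_n -> nat) :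
  measurable_fun setT (fun w => \prod_i P (f i) w).
Proof. by apply: measurable_prod => i _; exact: measurable_funP. Qed.

(** The absolute value makes the product nonnegative at every point, as [expectation_indep] demands;
    for the weights of a random discrete distribution this is known only almost surely. *)
Lemma expectation_prod_indep n (f : 'I_n -> nat) m (B : nat -> set R) :
  independent_sequences P U -> (forall i, measurable (B i)) ->
  (\int[Pr]_w (`|\prod_i P (f i) w| * \1_(\bigcap_(i in `I_m) U i @^-1` B i) w)%:E =
   Pr (\bigcap_(i in `I_m) U i @^-1` B i) * \int[Pr]_w (`|\prod_i P (f i) w|)%:E)%E.
Proof.
move=> PU mB; apply: expectation_indep => //.
- by apply: measurableT_comp => //; exact: measurable_prod_RV.
- exact: measurable_bigcap_preimage.
- move=> C mC; apply: PU; [exact: sigma_of_prod | exact: sigma_of_bigcap].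
Qed.

Hypothesis iidU : iid_uniform U.

Lemma uniform_ray (v : R) : 0 <= v <= 1 ->
  uniform_prob (@ltr01 R) `]-oo, v]%classic = v%:E.
Proof.
move=> /andP[v0 v1]; rewrite /uniform_prob integral_uniform_pdf.
rewrite (_ : _ `&` _ = `[0, v]%classic); last first.
  apply/seteqP; split => x /=; rewrite !in_itv/=; first by move=> [-> /andP[->]].
  by move=> /andP[-> xv]; rewrite xv (le_trans xv).
rewrite (eq_integral (fun=> 1%E)); last first.
  move=> x; rewrite inE/= in_itv/= /uniform_pdf => /andP[-> xv].
  by rewrite (le_trans xv)// subr0 invr1.
rewrite integral_cst//= mul1e lebesgue_measure_itv/= lte_fin.
case: ltP => [_|v0']; first by rewrite sube0.
by congr EFin; apply/le_anti; rewrite v0 v0'.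
Qed.

(** Each index in the image of f contributes one factor v, however often f takes it, and the other
    indices are unconstrained. This is the source of the exponent K_n. *)
Lemma uniform_orthant (v : R) m n (f : 'I_n -> 'I_m) : 0 <= v <= 1 ->
  Pr (\bigcap_(i in `I_m) U i @^-1`
        (if [exists l, f l == i :> nat] then `]-oo, v]%classic else setT)) =
  (v ^+ #|f @: [set: 'I_n]%SET|)%:E.
Proof.
move=> v01; case: iidU => Uu ->; last by move=> i; case: ifP.
rewrite (eq_bigr (fun i : 'I_m => ((if i \in f @: [set: 'I_n]%SET then v else
  1)%:E))).
  by rewrite prodEFin -big_mkcond/= prodr_const.
move=> i _; rewrite (_ : [exists l, _] = (i \in f @: [set: 'I_n]%SET)).
  case: ifP => _; first by rewrite Uu// uniform_ray.
  by rewrite preimage_setT probability_setT.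
by apply/existsP/imsetP => [[l /eqP il]|[l _ ->]]; exists l => //; exact/val_inj.
Qed.

Lemma uniform_cell (a b : R) : 0 <= a -> a <= b -> b <= 1 ->
  uniform_prob (@ltr01 R) `]a, b]%classic = (b - a)%:E.
Proof.
move=> a0 ab b1; rewrite /uniform_prob integral_uniform_pdf.
rewrite (_ : _ `&` _ = `]a, b]%classic); last first.
  apply/seteqP; split => x /=; rewrite !in_itv/=; first by case.
  move=> /andP[ax xb]; rewrite ax xb (le_trans xb)//.
  by rewrite (le_trans a0)// ltW.
rewrite (eq_integral (fun=> 1%E)); last first.
  move=> x; rewrite inE/= in_itv/= /uniform_pdf => /andP[ax xb].
  by rewrite (le_trans a0 (ltW ax)) (le_trans xb)// subr0 invr1.
rewrite integral_cst//= mul1e lebesgue_measure_itv/= lte_fin.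
case: ltP => [_|ba]; first by rewrite EFinB.
by rewrite (@le_anti _ _ a b) ?subrr ?ab ?ba.
Qed.

Lemma uniform_pair_indep i j (B C : set R) : i != j ->
  measurable B -> measurable C ->
  Pr (U i @^-1` B `&` U j @^-1` C) = (Pr (U i @^-1` B) * Pr (U j @^-1` C))%E.
Proof.
move=> ij mB mC; pose m := (maxn i j).+1.
have im : (i < m)%N by rewrite ltnS leq_maxl.
have jm : (j < m)%N by rewrite ltnS leq_maxr.
pose F k : set R := if k == i then B else if k == j then C else setT.
have ji : (j == i) = false by rewrite eq_sym; exact/negbTE.
have := iidU.2 m F; rewrite (bigD1 (Ordinal im))//= (bigD1 (Ordinal jm))/=;
  last first.
  by rewrite -val_eqE/= ji.
rewrite big1 => [|k /andP[]]; last first.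
  rewrite -!val_eqE/= /F => /negPf -> /negPf ->.
  by rewrite preimage_setT probability_setT.
rewrite mule1 {3 4}/F ji !eqxx => <-; last first.
  by move=> k; rewrite /F; case: ifP => // _; case: ifP.
congr (Pr _); apply/seteqP; split => [w [Bw Cw] k _|w H].
  by rewrite /F; case: eqP => [->|_]//; case: eqP => [->|_].
by split; [have := H i im|have := H j jm]; rewrite /F/= ?ji !eqxx.
Qed.

(** Cut ]0, 1] into L + 1 cells of equal length. Equal marks share a cell, which has probability (L
    + 1) / (L + 1)^2 = 1 / (L + 1) by independence, and L is arbitrary. *)
Lemma uniform_distinct i j : i != j -> Pr [set w | U i w = U j w] = 0%E.
Proof.
move=> ij; have mU k (B : set R) : measurable B -> measurable (U k @^-1` B).
  by move=> mB; rewrite -[X in measurable X]setTI; exact: measurable_funP.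
have mE : measurable [set w | U i w = U j w].
  rewrite -[X in measurable X]setTI.
  rewrite (_ : [set w | _] = (fun w => U i w == U j w) @^-1` [set true]).
    by apply: (measurable_fun_eqr _ _) => //; exact: measurable_funP.
  by apply/seteqP; split => w /=; [move=> ->; rewrite eqxx|move=> /eqP].
pose A L l := `](l%:R / L.+1%:R : R), (l.+1%:R / L.+1%:R)]%classic.
have PA k L l : (l < L.+1)%N -> Pr (U k @^-1` A L l) = (L.+1%:R^-1)%:E.
  move=> lL; rewrite iidU.1 /A; last exact: measurable_itv.
    rewrite uniform_cell.
  - by rewrite -mulrBl -natrB// subSnn mul1r.
  - by rewrite divr_ge0.
  - by rewrite ler_wpM2r ?invr_ge0// ler_nat.
  - by rewrite ler_pdivrMr// mul1r ler_nat.
(* The half-open cells cover ]0, 1] only; the remaining values of the mark form a null event. *)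
have P0 : Pr (~` (U i @^-1` `]0, 1])) = 0%E.
  rewrite probability_setC; last exact: mU.
  by rewrite iidU.1// uniform_cell// subr0 subee.
suff H L : (Pr [set w | U i w = U j w] <= (L.+1%:R^-1)%:E)%E.
  apply/le_anti/andP; split; last exact: measure_ge0.
  apply/lee_addgt0Pr => e e0; rewrite add0e.
  apply: le_trans (H (Num.truncn e^-1)) _; rewrite lee_fin.
  by rewrite invf_ple ?posrE// ltW// truncnS_gt.
have -> : (L.+1%:R^-1)%:E = (\sum_(l < L.+1)
    Pr (U i @^-1` A L l `&` U j @^-1` A L l) + Pr (~` (U i @^-1` `]0%R, 1%R])))%E.
  rewrite P0 adde0 (eq_bigr (fun=> (L.+1%:R^-1 * L.+1%:R^-1)%:E)) => [|l _].
    by rewrite sumEFin sumr_const card_ord -mulrnAl -[X in (X * _)%:E]mulr_natr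
      mulVf ?mul1r//.
  by rewrite uniform_pair_indep ?PA//; exact: measurable_itv.
apply: le_trans; last first.
  apply: leeD2r; apply: (@Boole_inequality _ _ _ Pr (fun l =>
    U i @^-1` A L l `&` U j @^-1` A L l) L.+1).
  by move=> l _; apply: measurableI; apply: mU; exact: measurable_itv.
apply: le_trans; last first.
  apply: measureU2; last by apply: measurableC; exact: mU.
  by apply: bigsetU_measurable => l _; apply: measurableI; apply: mU;
    exact: measurable_itv.
apply: le_measure; rewrite ?inE//.
  apply: measurableU; last by apply: measurableC; exact: mU.
  by apply: bigsetU_measurable => l _; apply: measurableI; apply: mU;
    exact: measurable_itv.
move=> w Uw; have [U01|] := pselect (0 < U i w <= 1); last by right;
  rewrite /= in_itv/=.
left; suff : (\bigcup_(l < L.+1) (U i @^-1` A L l `&` U j @^-1` A L l)) w.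
  by rewrite bigcup_mkord.
pose x := U i w * L.+1%:R.
have x0 : 0 < x by rewrite mulr_gt0//; case/andP: U01.
(* m is the ceiling of x minus one, because the cells are open on the left. *)
have [m /andP[mx xm]] : exists m : nat, m%:R < x <= m.+1%:R.
  have [n nx] : exists n : nat, x <= n%:R.
    by exists (Num.truncn x).+1; rewrite ltW// truncnS_gt.
  elim: n nx => [|n IHn] nx; first by move: x0; rewrite ltNge nx.
  by have [nx'|xn] := ltP n%:R x; [exists n; rewrite nx' | exact: IHn].
have mL : (m < L.+1)%N.
  rewrite -(ltr_nat R) (lt_le_trans mx)// /x ler_piMl//; by case/andP: U01.
have Am : A L m (U i w).
  by rewrite /A/= in_itv/= ltr_pdivrMr// ler_pdivlMr// mx xm.
by exists m => //; split => //=; rewrite -[U j w]Uw.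
Qed.

End Independence.

(** * Moments of the random distribution function *)

Lemma cvgX (R : realType) (u : nat -> R) (l : R) n :
  u @ \oo --> l -> u m ^+ n @[m --> \oo] --> l ^+ n.
Proof.
move=> ul; elim: n => [|n IHn]; first exact: cvg_cst.
by under eq_fun do rewrite exprS; rewrite exprS; exact: cvgM.
Qed.

Lemma cvg_big_sum (R : realType) (I : Type) (r : seq I) (A : pred I)
    (f : I -> nat -> R) (l : I -> R) :
  (forall i, f i m @[m --> \oo] --> l i) ->
  \sum_(i <- r | A i) f i m @[m --> \oo] --> \sum_(i <- r | A i) l i.
Proof.
move=> fl; elim: r => [|i r IHr].
  by under eq_fun do rewrite big_nil; rewrite big_nil; exact: cvg_cst.
under eq_fun do rewrite big_cons.
by rewrite big_cons; case: (A i) => //; apply: cvgD.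
Qed.

Section Series.
Variable R : realType.
Variables (p e : nat -> R).
Hypotheses (p0 : forall j, 0 <= p j) (p1 : (\sum_(0 <= j <oo) (p j)%:E = 1)%E).
Hypothesis e01 : forall j, 0 <= e j <= 1.

Lemma weighted_series_ge m :
  ((\sum_(j < m) p j * e j)%:E <= \sum_(0 <= j <oo) (p j * e j)%:E)%E.
Proof.
rewrite -sumEFin -(big_mkord xpredT (fun j => (p j * e j)%:E)).
by apply: nneseries_lim_ge => j _ _; rewrite lee_fin mulr_ge0//; case/andP: (e01 j).
Qed.

Lemma weighted_series_le1 : (\sum_(0 <= j <oo) (p j * e j)%:E <= 1)%E.
Proof.
rewrite -p1; apply: lee_nneseries => j *.
  by rewrite lee_fin mulr_ge0//; case/andP: (e01 j).
by rewrite lee_fin ler_piMr//; case/andP: (e01 j).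
Qed.

Lemma weighted_series_ge0 : (0 <= \sum_(0 <= j <oo) (p j * e j)%:E)%E.
Proof. by have := weighted_series_ge 0; rewrite big_ord0. Qed.

Lemma weighted_series_fin_num :
  (\sum_(0 <= j <oo) (p j * e j)%:E)%E \is a fin_num.
Proof.
rewrite ge0_fin_numE ?weighted_series_ge0//.
exact: le_lt_trans weighted_series_le1 (ltry _).
Qed.

Lemma cvg_weighted_series :
  \sum_(j < m) p j * e j @[m --> \oo] --> fine (\sum_(0 <= j <oo) (p j * e j)%:E)%E.
Proof.
suff : (\sum_(j < m) p j * e j)%:E @[m --> \oo] -->
    (fine (\sum_(0 <= j <oo) (p j * e j)%:E)%E)%:E by move/fine_cvg.
rewrite fineK ?weighted_series_fin_num//.
under eq_fun do rewrite -sumEFin -(big_mkord xpredT (fun j => (p j * e j)%:E)).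
have : cvgn (fun m => \sum_(0 <= j < m) (p j * e j)%:E)%E.
  apply: is_cvg_nneseries => j _ _; rewrite lee_fin mulr_ge0//.
  by case/andP: (e01 j).
exact.
Qed.

End Series.

(** * Moments of the truncated distribution and their limits *)

Section RandomDiscreteDistribution.
Context d (Omega : measurableType d) (R : realType) (Pr : probability Omega R).
Variables P U : nat -> {RV Pr >-> R}.
Variable D : set Omega.
Hypotheses (mD : measurable D) (DC0 : Pr (~` D) = 0%E).
(* Nothing is known about P outside D, so all integrals are taken over D. *)
Hypothesis P_good : forall w, D w -> (forall j, 0 <= P j w) /\
   (\sum_(0 <= j <oo) (P j w)%:E = 1)%E.

Lemma partial_sum_le1 m w : D w -> \sum_(j < m) P j w <= 1.
Proof.
move=> /P_good[P0 P1]; have := @weighted_series_ge _ (P ^~ w) (fun=> 1) P0 (fun=>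
  _) m.
have -> : (\sum_(0 <= j <oo) (P j w * 1)%:E = 1)%E.
  by rewrite -P1; apply: eq_eseriesr => j _; rewrite mulr1.
rewrite lee_fin; under eq_bigr do rewrite mulr1; apply.
by move=> _; rewrite ler01 lexx.
Qed.

Lemma P_le1 j w : D w -> P j w <= 1.
Proof.
move=> Dw; apply: le_trans (partial_sum_le1 j.+1 Dw).
by rewrite big_ord_recr/= lerDr sumr_ge0// => i _; case: (P_good Dw).
Qed.

Lemma bounded_meas_P j : bounded_meas D (P j).
Proof.
split; first exact: measurable_funP.
by exists 1 => w Dw; rewrite ger0_norm ?P_le1//; case: (P_good Dw).
Qed.

Lemma bounded_meas_prodP n (f : 'I_n -> nat) : bounded_meas D (fun w =>
  \prod_i P (f i) w).
Proof. by apply: bounded_meas_prod => i; exact: bounded_meas_P. Qed.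

(* The expected mass of the samples of size n that take k distinct values, all
   below m. *)
Definition distinct_mass n m k : R :=
  (\int[Pr]_(w in D) \sum_(f : {ffun 'I_n -> 'I_m} | #|f @: [set: 'I_n]%SET| == k)
     \prod_i P (f i) w)%R.

Lemma distinct_massE n m k : distinct_mass n m k =
  \sum_(f : {ffun 'I_n -> 'I_m} | #|f @: [set: 'I_n]%SET| == k)
     (\int[Pr]_(w in D) \prod_i P (f i) w)%R.
Proof. by rewrite /distinct_mass Rintegral_bsum// => f;
  exact: bounded_meas_prodP. Qed.

Lemma card_im_le n m (f : {ffun 'I_n -> 'I_m}) : (#|f @: [set: 'I_n]%SET| < n.+1)%N.
Proof. by rewrite ltnS (leq_trans (leq_imset_card _ _))// cardsT card_ord. Qed.

Lemma partial_cdf_moment n m v : iid_uniform U -> independent_sequences P U ->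
  0 <= v <= 1 ->
  (\int[Pr]_(w in D) (\sum_(j < m) P j w * (U j w <= v)%R%:R) ^+ n)%R =
  \sum_(k < n.+1) distinct_mass n m k * v ^+ k.
Proof.
move=> iidU PU v01.
(* In the term of f the mark indicators multiply to the indicator that U_i <= v for every i in the
   image of f, which is the event [E f] below. *)
pose B (f : {ffun 'I_n -> 'I_m}) i : set R :=
  if [exists l, f l == i :> nat] then `]-oo, v]%classic else setT.
have mB f i : measurable (B f i) by rewrite /B; case: ifP.
pose E f := \bigcap_(i in `I_m) U i @^-1` B f i.
have mE f : measurable (E f) by exact: measurable_bigcap_preimage.
have powE w : (\sum_(j < m) P j w * (U j w <= v)%R%:R) ^+ n =
    \sum_(f : {ffun 'I_n -> 'I_m}) \prod_i P (f i) w * \1_(E f) w.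
  rewrite -[n in LHS]card_ord -prodr_const bigA_distr_bigA; apply: eq_bigr => f _.
  rewrite big_split/=; congr (_ * _); rewrite indicE.
  have [Ef|nEf] := boolP (w \in E f).
    rewrite big1// => i _; move: Ef; rewrite inE => /(_ (f i) (ltn_ord _)).
    rewrite /B ifT/=; last by apply/existsP; exists i.
    by rewrite in_itv/= => ->.
  apply/eqP; rewrite prodf_seq_eq0; apply/hasPn => H.
  move: nEf; rewrite notin_setE; apply => i im; rewrite /B/=;
    case: ifP => // /existsP[l /eqP <-].
  have := H l (mem_index_enum _); rewrite /= pnatr_eq0 eqb0 negbK in_itv/=.
  by [].
under eq_Rintegral do rewrite powE.
rewrite (Rintegral_bsum Pr mD) => [|f]; last first.
  by apply: bounded_measM; [exact: bounded_meas_prodP|exact: bounded_meas_indic].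
transitivity (\sum_(f : {ffun 'I_n -> 'I_m})
    (\int[Pr]_(w in D) \prod_i P (f i) w)%R * v ^+ #|f @: [set: 'I_n]%SET|).
  apply: eq_bigr => f _; apply: EFin_inj.
  (* On D the absolute value imposed by [expectation_prod_indep] disappears. *)
  have absE w : D w -> `|\prod_i P (f i) w| = \prod_i P (f i) w.
    by move=> Dw; rewrite ger0_norm// prodr_ge0// => i _; case: (P_good Dw).
  have bP : bounded_meas D (fun w => `|\prod_i P (f i) w|).
    by apply: bounded_meas_norm; exact: bounded_meas_prodP.
  have := expectation_prod_indep (fun i => f i : nat) m PU (mB f).
  rewrite (Rintegral_fullE mD DC0); last first.
    by apply: bounded_measM; [exact: bP|apply: bounded_meas_indic; exact: mE].
  rewrite (Rintegral_fullE mD DC0)// uniform_orthant// -EFinM mulrC.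
  rewrite (@eq_Rintegral _ _ _ _ D (fun w => \prod_i P (f i) w * \1_(E f) w)).
    move=> ->; congr (_ * _)%:E; apply: eq_Rintegral => w; rewrite inE.
    exact: absE.
  by move=> w; rewrite inE => Dw; rewrite absE.
rewrite (partition_big (fun f : {ffun 'I_n -> 'I_m} =>
  Ordinal (card_im_le f)) predT)//=.
apply: eq_bigr => k _; rewrite distinct_massE mulr_suml.
apply: eq_big => [f|f /eqP <-]; first by rewrite -val_eqE.
by [].
Qed.

(** The same expansion without marks. It bounds the masses by 1 and shows that their limits sum to
    1, the normalization that turns inequalities between laws into equalities. *)
Lemma partial_total_moment n m :
  (\int[Pr]_(w in D) (\sum_(j < m) P j w) ^+ n)%R =
  \sum_(k < n.+1) distinct_mass n m k.
Proof.
under eq_Rintegral do rewrite -[n in _ ^+ n]card_ord -prodr_const bigA_distr_bigA.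
rewrite (Rintegral_bsum Pr mD) => [|f]; last exact: bounded_meas_prodP.
rewrite (partition_big (fun f : {ffun 'I_n -> 'I_m} =>
  Ordinal (card_im_le f)) predT)//=.
apply: eq_bigr => k _; rewrite distinct_massE.
by apply: eq_bigl => f; rewrite -val_eqE.
Qed.

Lemma ler01_bool (b : bool) : 0 <= (b%:R : R) <= 1.
Proof. by case: b; rewrite ?lexx ler01. Qed.

Lemma random_cdf_cvg v w : D w ->
  \sum_(j < m) P j w * (U j w <= v)%R%:R @[m --> \oo] --> random_cdf P U v w.
Proof.
by move=> /P_good[P0 P1]; apply: cvg_weighted_series => // j; exact: ler01_bool.
Qed.

Lemma random_cdf_itv v w : D w -> 0 <= random_cdf P U v w <= 1.
Proof.
move=> /P_good[P0 P1]; have b01 j : 0 <= ((U j w <= v)%R%:R : R) <= 1 by exact: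
  ler01_bool.
apply/andP; split; first by rewrite fine_ge0// weighted_series_ge0.
by rewrite -lee_fin fineK ?weighted_series_fin_num// weighted_series_le1.
Qed.

Lemma bounded_meas_random_cdf v : bounded_meas D (random_cdf P U v).
Proof.
split; first exact: measurable_random_cdf.
by exists 1 => w Dw; case/andP: (random_cdf_itv v Dw) => F0 F1; rewrite ger0_norm.
Qed.

Lemma cvg_cdf_moment n v : iid_uniform U -> independent_sequences P U ->
  0 <= v <= 1 ->
  \sum_(k < n.+1) distinct_mass n m k * v ^+ k @[m --> \oo] -->
  (\int[Pr]_(w in D) random_cdf P U v w ^+ n)%R.
Proof.
move=> iidU PU v01; under eq_fun do rewrite -partial_cdf_moment//.
apply: (@bounded_convergence _ _ _ _ _ mD _ _ 1).
- move=> m; apply: measurable_funX; apply: measurable_sum => j.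
  apply: measurable_funM; first exact: measurable_funP.
  apply: (measurableT_comp (f := fun b : bool => b%:R : R)) => //.
  by apply: measurable_fun_ler.
- by apply: measurable_funX; exact: measurable_random_cdf.
- move=> m w Dw; have [P0 P1] := P_good Dw.
  have s0 : 0 <= \sum_(j < m) P j w * (U j w <= v)%R%:R.
    by apply: sumr_ge0 => j _; rewrite mulr_ge0.
  rewrite ger0_norm ?exprn_ge0// exprn_ile1//.
  apply: le_trans (partial_sum_le1 m Dw); apply: ler_sum => j _.
  by rewrite ler_piMr//; case: (_ <= v); rewrite // ler01.
- by move=> w Dw; apply: cvgX; exact: random_cdf_cvg.
Qed.

Lemma cvg_total_moment n :
  \sum_(k < n.+1) distinct_mass n m k @[m --> \oo] --> (1 : R).
Proof.
under eq_fun do rewrite -partial_total_moment//.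
have <- : (\int[Pr]_(w in D) (cst 1 w) = 1 :> R)%R.
  by rewrite Rintegral_cst// -[fine (_ D)]/(fine (Pr D)) (full_measure mD DC0)
    mul1r.
apply: (@bounded_convergence _ _ _ _ _ mD _ _ 1) => //.
- by move=> m; apply: measurable_funX; apply: measurable_sum => j;
  exact: measurable_funP.
- move=> m w Dw; have [P0 P1] := P_good Dw.
  have s0 : 0 <= \sum_(j < m) P j w by exact: sumr_ge0.
  by rewrite ger0_norm ?exprn_ge0// exprn_ile1// partial_sum_le1.
- move=> w Dw; have [P0 P1] := P_good Dw; rewrite -[cst 1 w](expr1n _ n).
  apply: cvgX; rewrite [X in _ --> X](_ : _ =
    fine (\sum_(0 <= j <oo) (P j w * 1)%:E)%E).
    have := cvg_weighted_series P0 P1 (fun=> ler01_bool true).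
    by under eq_fun do under eq_bigr do rewrite mulr1.
  by under eq_eseriesr do rewrite mulr1; rewrite P1.
Qed.

Lemma distinct_mass_ge0 n m k : 0 <= distinct_mass n m k.
Proof.
apply: Rintegral_ge0 => w Dw; apply: sumr_ge0 => f _; apply: prodr_ge0 => i _.
by case: (P_good Dw).
Qed.

(** By [sum_prod_compositions] the mass is a finite combination, over compositions, of sums over
    injections into ['I_m], and these increase to [partition_prob]. The limit is taken in the
    extended reals because the ECPF is not yet known to be finite. *)
Lemma cvg_distinct_mass n k :
  (distinct_mass n m k)%:E @[m --> \oo] -->
  (\sum_(c in compositions n k) ecpf P (fun i => nat_of_ord (c i)))%E.
Proof.
pose a (c : {ffun 'I_k -> 'I_n.+1}) (j : {ffun 'I_k -> nat}) : \bar R :=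
  ('E_Pr[(fun w => \prod_(i < k) P (j i) w ^+ c i)%R])%E.
have bP (c : {ffun 'I_k -> 'I_n.+1}) (j : 'I_k -> nat) :
    bounded_meas D (fun w => \prod_(i < k) P (j i) w ^+ c i).
  by apply: bounded_meas_prod => i; apply: bounded_measX; exact: bounded_meas_P.
have aE c j : a c j = (\int[Pr]_(w in D) \prod_(i < k) P (j i) w ^+ c i)%R%:E.
  exact: expectation_fullE.
have a0 c j : (0 <= a c j)%E.
  rewrite aE lee_fin; apply: Rintegral_ge0 => w Dw; apply: prodr_ge0 => i _.
  by rewrite exprn_ge0//; case: (P_good Dw).
pose coef (c : {ffun 'I_k -> 'I_n.+1}) : R :=
  k`!%:R^-1 * ((\sum_(i < k) c i)%N`!%:R / \prod_(i < k) (c i)`!%:R).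
have coef0 c : 0 <= coef c.
  by rewrite mulr_ge0 ?invr_ge0// divr_ge0// prodr_ge0.
have massE m : (distinct_mass n m k)%:E = (\sum_(c in compositions n k)
    (coef c)%:E * \sum_(g : {ffun 'I_k -> 'I_m} | injectiveb g)
      a c [ffun i => val (g i)])%E.
  rewrite /distinct_mass.
  under eq_Rintegral do rewrite (sum_prod_compositions n k (fun j : 'I_m => P j _)).
  rewrite (Rintegral_bsum Pr mD) => [|c]; last first.
    apply: bounded_measM; first exact: bounded_meas_cst.
    by apply: bounded_meas_sum => g; exact: bP.
  rewrite -sumEFin; apply: eq_bigr => c _.
  rewrite RintegralZl//; last first.
    by apply: bounded_meas_integrable => //; apply: bounded_meas_sum => g;
      exact: bP.
  rewrite EFinM (Rintegral_bsum Pr mD) => [|g]; last exact: bP.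
  rewrite -sumEFin; congr (_ * _)%E; apply: eq_bigr => g _; rewrite aE; congr EFin.
  by apply: eq_Rintegral => w _; apply: eq_bigr => i _; rewrite ffunE.
under eq_fun do rewrite massE.
apply: cvg_nnesum => c _.
  by apply: nearW => m; rewrite mule_ge0 ?lee_fin// sume_ge0.
by apply: cvgeZl => //; exact: cvg_esum_injections.
Qed.

(** The intended value of the probability that K_n = k, as a real number. For k <= n, [fine]
    discards nothing: the sum is a limit of masses between 0 and 1. *)
Definition distinct_prob n k : R :=
  fine (\sum_(c in compositions n k) ecpf P (fun i => nat_of_ord (c i)))%E.

Lemma distinct_mass_le1 n m k : (k < n.+1)%N -> distinct_mass n m k <= 1.
Proof.
move=> kn; apply: (@le_trans _ _ (\sum_(k < n.+1) distinct_mass n m k)).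
  rewrite (bigD1 (Ordinal kn))//= lerDl sumr_ge0// => i _.
  exact: distinct_mass_ge0.
rewrite -partial_total_moment; apply: (@le_trans _ _ (\int[Pr]_(w in D) (cst 1
  w))%R).
  apply: le_Rintegral => //.
  - apply: bounded_meas_integrable => //; apply: bounded_measX.
    by apply: bounded_meas_sum => j; exact: bounded_meas_P.
  - by apply: bounded_meas_integrable => //; exact: bounded_meas_cst.
  - move=> w Dw; rewrite exprn_ile1 ?partial_sum_le1// sumr_ge0// => j _.
    by case: (P_good Dw).
by rewrite Rintegral_cst// -[fine (_ D)]/(fine (Pr D)) (full_measure mD DC0) mul1r.
Qed.

Lemma distinct_probE n k : (k < n.+1)%N ->
  (\sum_(c in compositions n k) ecpf P (fun i => nat_of_ord (c i)))%E =
  (distinct_prob n k)%:E.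
Proof.
move=> kn; rewrite fineK//; have cm := @cvg_distinct_mass n k.
rewrite fin_numElt; apply/andP; split.
  apply: (@lt_le_trans _ _ 0%E) => //; apply: (cvge_to_ge cm).
  by apply: nearW => m; rewrite lee_fin distinct_mass_ge0.
apply: (@le_lt_trans _ _ 1%E); last exact: ltry.
by apply: (cvge_to_le cm); apply: nearW => m; rewrite lee_fin distinct_mass_le1.
Qed.

Lemma cvg_distinct_prob n k : (k < n.+1)%N ->
  distinct_mass n m k @[m --> \oo] --> distinct_prob n k.
Proof.
by move=> kn; have := @cvg_distinct_mass n k; rewrite distinct_probE// => /fine_cvg.
Qed.

Lemma distinct_prob_sum n : \sum_(k < n.+1) distinct_prob n k = 1.
Proof.
apply: (cvg_unique _ _ (cvg_total_moment n)) => //.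
by apply: cvg_big_sum => k; exact: cvg_distinct_prob.
Qed.

Lemma random_cdf_moment n v : iid_uniform U -> independent_sequences P U ->
  0 <= v <= 1 ->
  (\int[Pr]_(w in D) random_cdf P U v w ^+ n)%R =
  \sum_(k < n.+1) distinct_prob n k * v ^+ k.
Proof.
move=> iidU PU v01; have lim1 := cvg_cdf_moment (n := n) iidU PU v01.
have lim2 : \sum_(k < n.+1) distinct_mass n m k * v ^+ k @[m --> \oo] -->
    \sum_(k < n.+1) distinct_prob n k * v ^+ k.
  by apply: cvg_big_sum => k; apply: cvgMl; exact: cvg_distinct_prob.
by rewrite -(cvg_lim (@Rhausdorff R) lim1) -(cvg_lim (@Rhausdorff R) lim2).
Qed.

Lemma distinct_prob0 n : (0 < n)%N -> distinct_prob n 0 = 0.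
Proof.
move=> n0; rewrite /distinct_prob big1 ?fine0// => c.
by rewrite inE big_ord0 eq_sym => /andP[_ /eqP n00]; rewrite n00 in n0.
Qed.

End RandomDiscreteDistribution.

(** * Number of distinct values of a sample *)

Lemma size_undup_map_inj (A B : eqType) (f : A -> B) (s : seq A) :
  {in s &, injective f} -> size (undup (map f s)) = size (undup s).
Proof.
move=> finj; rewrite -[RHS](size_map f); apply/perm_size/uniq_perm.
- exact: undup_uniq.
- rewrite map_inj_in_uniq ?undup_uniq// => x y; rewrite !mem_undup; exact: finj.
- move=> y; rewrite mem_undup; apply/mapP/mapP => -[x xs ->]; exists x => //.
    by rewrite mem_undup.
  by rewrite -mem_undup.
Qed.

Lemma size_undup_card (n : nat) (V : finType) (c : {ffun 'I_n -> V}) :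
  size (undup [seq c i | i <- enum 'I_n]) = #|c @: [set: 'I_n]%SET|.
Proof.
rewrite -(card_uniqP (undup_uniq _)); apply: eq_card => v; rewrite mem_undup.
apply/mapP/imsetP => -[i _ ->]; exists i => //; by rewrite mem_enum.
Qed.

(** * Countable separating families and the finite partitions they generate *)

Section SeparatingSets.
Context d' (T : measurableType d') (Sep : nat -> set T).
Hypothesis mSep : forall i, measurable (Sep i).
Hypothesis Sep_inj : forall s t, (forall i, Sep i s <-> Sep i t) -> s = t.

(* The first N separating sets, read as a finite measurable partition of T. *)
Definition code N (t : T) : {ffun 'I_N -> bool} := [ffun i => t \in Sep (val i)].

Lemma codeP N s t :
  code N s = code N t <-> forall i, (i < N)%N -> (Sep i s <-> Sep i t).
Proof.
split => [/ffunP st i iN|st].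
  have := st (Ordinal iN); rewrite !ffunE/= => e.
  by split => /mem_set; [rewrite e|rewrite -e] => /set_mem.
apply/ffunP => i; rewrite !ffunE/=; apply/idP/idP => /set_mem ?; apply: mem_set;
  exact/st.
Qed.

Lemma measurable_cell N v : measurable [set t | code N t = v].
Proof.
rewrite (_ : [set t | _] = \bigcap_(i in [set: 'I_N])
    (if v i then Sep (val i) else ~` Sep (val i))).
  by apply: fin_bigcap_measurable => // i _; case: ifP => _; [|exact: measurableC].
apply/seteqP; split => [t <- i _|t H].
  by rewrite ffunE; case: ifPn => [/set_mem|]//; rewrite notin_setE.
apply/ffunP => i; rewrite ffunE; have := H i I.
by case: (v i) => Ht; [exact: mem_set|apply/negbTE; rewrite notin_setE].
Qed.

Context d (Omega : measurableType d) (R : realType) (Pr : probability Omega R).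
Implicit Types X Y : Omega -> T.

Definition agree N X Y : set Omega := [set w | code N (X w) = code N (Y w)].

Lemma measurable_agree N X Y : measurable_fun setT X -> measurable_fun setT Y ->
  measurable (agree N X Y).
Proof.
move=> mX mY; rewrite (_ : agree N X Y = \bigcup_(v in [set: {ffun 'I_N -> bool}])
  (X @^-1` [set t | code N t = v] `&` Y @^-1` [set t | code N t = v])).
  apply: fin_bigcup_measurable => // v _; apply: measurableI.
    by rewrite -[X in measurable X]setTI; apply: mX => //; exact: measurable_cell.
  by rewrite -[X in measurable X]setTI; apply: mY => //; exact: measurable_cell.
apply/seteqP; split => [w e|w [v _ [/= Xv Yv]]]; last by rewrite /agree/= Xv Yv.
by exists (code N (X w)).
Qed.

Lemma bigcap_agree X Y : \bigcap_N agree N X Y = [set w | X w = Y w].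
Proof.
apply/seteqP; split => [w H|w /= e N _]; last by rewrite /agree/= e.
by apply: Sep_inj => i; have /codeP := H i.+1 I; apply.
Qed.

(** The separating family is countable, so equality is the countable intersection of the events that
    X and Y have the same code at level N. *)
Lemma measurable_eq_set X Y : measurable_fun setT X -> measurable_fun setT Y ->
  measurable [set w | X w = Y w].
Proof.
move=> mX mY; rewrite -bigcap_agree; apply: bigcapT_measurable => N.
exact: measurable_agree.
Qed.

Lemma cvg_agree X Y : measurable_fun setT X -> measurable_fun setT Y ->
  fine (Pr (agree N X Y)) @[N --> \oo] --> fine (Pr [set w | X w = Y w]).
Proof.
move=> mX mY; suff : Pr (agree N X Y) @[N --> \oo] --> (fine (Pr [set w | X w =
  Y w]))%:E.
  by move/fine_cvg.
rewrite fineK ?fin_num_measure//; last exact: measurable_eq_set.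
rewrite -bigcap_agree; apply: nonincreasing_cvg_mu.
- by rewrite (le_lt_trans (probability_le1 _ _)) ?ltry//; exact: measurable_agree.
- by move=> N; exact: measurable_agree.
- by rewrite bigcap_agree; exact: measurable_eq_set.
- move=> N N' NN'; apply/subsetPset => w /codeP H; apply/codeP => i iN.
  by apply: H; exact: leq_trans NN'.
Qed.

(** [undup] drops the head exactly when it recurs in the tail, so the head adds the indicator that
    its value differs from all later ones, a measurable event by [measurable_eq_set]. *)
Lemma measurable_size_undup (I : Type) (X : I -> Omega -> T) (r : seq I) :
  (forall i, measurable_fun setT (X i)) ->
  measurable_fun setT (fun w => (size (undup [seq X i w | i <- r]))%:R : R).
Proof.
move=> mX; elim: r => [|i r IHr]; first exact: measurable_cst.
pose dup := \bigcup_(l in `I_(size r)) [set w | X i w = X (nth i r l) w].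
have mdup : measurable dup.
  by apply: fin_bigcup_measurable => // l _; exact: measurable_eq_set.
rewrite (_ : (fun w => _) = fun w => \1_(~` dup) w +
    (size (undup [seq X j w | j <- r]))%:R).
  by apply: measurable_funD => //; apply: measurable_indic; exact: measurableC.
apply/funext => w; rewrite /= indicE.
have -> : (X i w \in [seq X j w | j <- r]) = (w \in dup).
  apply/idP/idP => [/(nthP (X i w))[l]|/set_mem[l /= lr Xl]].
    rewrite size_map => lr; rewrite (nth_map i)// => Xl.
    by apply: mem_set; exists l => //=.
  by rewrite Xl -(nth_map i (X i w) (fun j => X j w))// mem_nth// size_map.
rewrite in_setC; case: (w \in dup) => /=; first by rewrite add0r.
by rewrite -natr1 addrC.
Qed.

Lemma measurable_distinct_values n (Y : 'I_n -> Omega -> T) k :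
  (forall i, measurable_fun setT (Y i)) ->
  measurable [set w | distinct_values Y w = k].
Proof.
move=> mY; have := @measurable_size_undup _ Y (enum 'I_n) mY.
move=> /(_ measurableT [set k%:R] (measurable_set1 _)); rewrite setTI.
congr measurable; apply/seteqP; split => w /=;
  last by rewrite /distinct_values => ->.
by move/eqP; rewrite eqr_nat => /eqP.
Qed.

End SeparatingSets.

Lemma distinct_values_le (Omega : Type) (T : eqType) n (X : 'I_n -> Omega -> T) w :
  (distinct_values X w < n.+1)%N.
Proof.
rewrite ltnS /distinct_values (leq_trans (size_undup _))// size_map.
by rewrite -cardE card_ord.
Qed.

(** * Law of the number of distinct values, for almost surely distinct atoms *)

Section SampleCount.
Context d (Omega : measurableType d) (R : realType) (Pr : probability Omega R).
Variables P : nat -> {RV Pr >-> R}.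
Variable D : set Omega.
Hypotheses (mD : measurable D) (DC0 : Pr (~` D) = 0%E).
Hypothesis P_good : forall w, D w -> (forall j, 0 <= P j w) /\
   (\sum_(0 <= j <oo) (P j w)%:E = 1)%E.
Context d' (T : measurableType d') (Sep : nat -> set T).
Hypothesis mSep : forall i, measurable (Sep i).
Hypothesis Sep_inj : forall s t, (forall i, Sep i s <-> Sep i t) -> s = t.
Variable x : nat -> Omega -> T.
Hypothesis mx : forall j, measurable_fun setT (x j).
Hypothesis x_distinct : forall i j, i != j -> Pr [set w | x i w = x j w] = 0%E.
Variables (n : nat) (Y : 'I_n -> Omega -> T).
Hypothesis mY : forall i, measurable_fun setT (Y i).
Hypothesis Y_law : forall B : 'I_n -> set T, (forall i, measurable (B i)) ->
  Pr (\bigcap_(i in [set: 'I_n]) Y i @^-1` B i) =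
  (\int[Pr]_w \prod_(i < n) atomic (fun j => P j w) (fun j => x j w) (B i))%E.

Local Notation pr A := (fine (Pr A)).

Lemma partial_atomic_le m (B : set T) w : D w ->
  0 <= \sum_(j < m) P j w * \1_B (x j w) <=
    fine (atomic (fun j => P j w) (fun j => x j w) B).
Proof.
move=> /P_good[P0 P1]; have e01 j : 0 <= (\1_B (x j w) : R) <= 1.
  by rewrite indicE ler01_bool.
apply/andP; split.
  by apply: sumr_ge0 => j _; rewrite mulr_ge0//; case/andP: (e01 j).
rewrite -lee_fin fineK; first exact: (@weighted_series_ge _ (P ^~ w)).
exact: (@weighted_series_fin_num _ (P ^~ w)).
Qed.

(** On D the first m atoms give each B i at most its full mass; multiply these inequalities and
    integrate. *)
Lemma sample_law_ge m (B : 'I_n -> set T) : (forall i, measurable (B i)) ->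
  (\int[Pr]_(w in D) \prod_i \sum_(j < m) P j w * \1_(B i) (x j w))%R <=
  pr (\bigcap_(i in [set: 'I_n]) Y i @^-1` B i).
Proof.
move=> mB; pose mu i w := atomic (fun j => P j w) (fun j => x j w) (B i).
have mmu i : measurable_fun setT (mu i) by exact: measurable_atomic.
have mF : measurable_fun setT (fun w => \prod_(i < n) mu i w)%E.
  elim: (index_enum _) => [|i r IHr].
    by under eq_fun do rewrite big_nil; exact: measurable_cst.
  by under eq_fun do rewrite big_cons; exact: emeasurable_funM.
have mu01 i w : D w -> 0 <= fine (mu i w) <= 1.
  move=> /P_good[P0 P1]; have e01 j : 0 <= (\1_(B i) (x j w) : R) <= 1.
    by rewrite indicE ler01_bool.
  apply/andP; split; first by rewrite fine_ge0// (@weighted_series_ge0 _ (P ^~ w)).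
  rewrite -lee_fin fineK; first exact: (@weighted_series_le1 _ (P ^~ w)).
  exact: (@weighted_series_fin_num _ (P ^~ w)).
have mufin i w : D w -> mu i w \is a fin_num.
  move=> /P_good[P0 P1]; apply: (@weighted_series_fin_num _ (P ^~ w)) => // j.
  by rewrite indicE ler01_bool.
rewrite Y_law// (integral_fullE mD DC0)//.
rewrite (eq_integral (fun w => (\prod_(i < n) fine (mu i w))%:E)); last first.
  move=> w /set_mem Dw; rewrite -prodEFin; apply: eq_bigr => i _.
  by rewrite fineK// mufin.
apply: le_Rintegral => //.
- apply: bounded_meas_integrable => //; apply: bounded_meas_prod => i.
  apply: bounded_meas_sum => j; apply: bounded_measM; first exact: bounded_meas_P.
  split; first by apply: measurableT_comp => //; exact: measurable_indic.
  by exists 1 => w _; rewrite ger0_norm indicE;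
    case/andP: (@ler01_bool R (x j w \in B i)).
- apply: bounded_meas_integrable => //; apply: bounded_meas_prod => i; split.
    by apply: measurableT_comp => //; exact: fine_measurable.
  by exists 1 => w Dw; case/andP: (mu01 i w Dw) => ? ?; rewrite ger0_norm.
- move=> w Dw; apply: ler_prod => i _; exact: partial_atomic_le.
Qed.

Lemma sum_indic_pairs (I : finType) (A : pred (I * I)) (h : I * I -> R) i j :
  (forall ij, A ij -> 0 <= h ij) -> A (i, j) -> h (i, j) = 1 ->
  1 <= \sum_(ij | A ij) h ij.
Proof.
move=> h0 Aij hij; rewrite (bigD1 (i, j))//= hij lerDl sumr_ge0// => ij /andP[? _].
exact: h0.
Qed.

(** Exactly one c matches the codes of the sample, so the left side indicates that these codes take
    k values. If distinct sample values have distinct codes, the two counts agree; otherwise some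
    colliding pair makes the correction at least 1. *)
Lemma coded_samples_le N k w :
  \sum_(c : {ffun 'I_n -> {ffun 'I_N -> bool}} | #|c @: [set: 'I_n]%SET| == k)
    \1_(\bigcap_(i in [set: 'I_n]) Y i @^-1` [set t | code Sep N t = c i]) w <=
  \1_[set w | distinct_values Y w = k] w +
  \sum_(ij : 'I_n * 'I_n) (\1_(agree Sep N (Y ij.1) (Y ij.2)) w -
     \1_[set w | Y ij.1 w = Y ij.2 w] w) :> R.
Proof.
pose c0 : {ffun 'I_n -> {ffun 'I_N -> bool}} := [ffun i => code Sep N (Y i w)].
have -> : \sum_(c : {ffun 'I_n -> {ffun 'I_N -> bool}} | #|c @: [set: 'I_n]%SET| ==
  k)
    \1_(\bigcap_(i in [set: 'I_n]) Y i @^-1` [set t | code Sep N t = c i]) w =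
    (#|c0 @: [set: 'I_n]%SET| == k)%:R :> R.
  rewrite big_mkcond (bigD1 c0)//= big1 ?addr0 => [|c cc0].
    rewrite indicE mem_set; last by move=> i _; rewrite /= ffunE.
    by case: ifP.
  case: ifP => // _; rewrite indicE memNset// => H; case/eqP: cc0.
  by apply/ffunP => i; rewrite ffunE; have := H i I.
have h0 (ij : 'I_n * 'I_n) : true -> 0 <= \1_(agree Sep N (Y ij.1) (Y ij.2)) w -
     \1_[set w | Y ij.1 w = Y ij.2 w] w :> R.
  move=> _; rewrite subr_ge0 !indicE; have [/set_mem Yij|_] := boolP (w \in [set w
    | Y ij.1 w = Y ij.2 w]).
    by rewrite mem_set// /agree/= Yij.
  by case/andP: (@ler01_bool R (w \in agree Sep N (Y ij.1) (Y ij.2))).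
have [[i [j [aij Yij]]]|noij] := pselect (exists i j,
    agree Sep N (Y i) (Y j) w /\ Y i w <> Y j w).
  apply: (@le_trans _ _ 1); first by case/andP: (@ler01_bool R (#|c0 @: [set:
    'I_n]%SET| == k)).
  apply: ler_wpDl; first by rewrite indicE.
  apply: (@sum_indic_pairs _ xpredT _ i j) => //=.
  by rewrite !indicE mem_set// memNset// subr0.
apply: ler_wpDr; first by apply: sumr_ge0 => ij _; exact: h0.
rewrite indicE -size_undup_card.
have -> : [seq c0 i | i <- enum 'I_n] = [seq code Sep N t | t <- [seq Y i w | i <-
  enum 'I_n]].
  by rewrite -map_comp; apply: eq_map => i; rewrite /= ffunE.
rewrite size_undup_map_inj.
  rewrite -[size _]/(distinct_values Y w).
  by case: eqP => // e; rewrite mem_set.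
move=> _ _ /mapP[i _ ->] /mapP[j _ ->] cij; apply: contrapT => Yij.
by apply: noij; exists i, j.
Qed.

(** Expanding the right side gives the sum over those f for which the coded atoms x (f i) take k
    values. If the first m atoms have distinct codes, this is the sum on the left; otherwise the
    subtracted term is at least 1, while the mass is at most 1, so the left side is at most 0. *)
Lemma coded_mass_ge N m k w : D w ->
  \sum_(f : {ffun 'I_n -> 'I_m} | #|f @: [set: 'I_n]%SET| == k) \prod_i P (f i) w -
    \sum_(ij : 'I_m * 'I_m | ij.1 != ij.2) \1_(agree Sep N (x ij.1) (x ij.2)) w <=
  \sum_(c : {ffun 'I_n -> {ffun 'I_N -> bool}} | #|c @: [set: 'I_n]%SET| == k)
    \prod_i \sum_(j < m) P j w * \1_[set t | code Sep N t = c i] (x j w).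
Proof.
move=> Dw; have [P0 _] := P_good Dw.
pose g (f : {ffun 'I_n -> 'I_m}) : {ffun 'I_n -> {ffun 'I_N -> bool}} :=
  [ffun i => code Sep N (x (f i) w)].
have -> : \sum_(c : {ffun 'I_n -> {ffun 'I_N -> bool}} | #|c @: [set: 'I_n]%SET| ==
  k)
    \prod_i \sum_(j < m) P j w * \1_[set t | code Sep N t = c i] (x j w) =
    \sum_(f : {ffun 'I_n -> 'I_m} | #|g f @: [set: 'I_n]%SET| == k) \prod_i P (f i)
      w.
  under eq_bigr do rewrite bigA_distr_bigA.
  rewrite exchange_big/= [RHS]big_mkcond; apply: eq_bigr => f _.
  rewrite big_mkcond (bigD1 (g f))//= [X in _ + X]big1 ?addr0 => [|c cg].
    case: ifP => // _; apply: eq_bigr => i _.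
    by rewrite indicE mem_set ?mulr1// /g ffunE.
  case: ifP => // _; apply/eqP; rewrite prodf_seq_eq0; apply/hasPn => H.
  case/eqP: cg; apply/ffunP => i; rewrite ffunE.
  have := H i (mem_index_enum _); rewrite /= mulf_eq0 negb_or => /andP[_].
  rewrite indicE; case: (boolP (_ \in _)) => [/set_mem/= ->//|_]; by rewrite eqxx.
have [[i [j [ij aij]]]|noij] := pselect (exists i j : 'I_m,
    i != j /\ agree Sep N (x i) (x j) w).
  apply: (@le_trans _ _ 0); last first.
    by apply: sumr_ge0 => f _; apply: prodr_ge0.
  rewrite subr_le0; apply: (@le_trans _ _ 1).
    apply: (@le_trans _ _ ((\sum_(j < m) P j w) ^+ n)).
      rewrite -[n in leRHS]card_ord -prodr_const bigA_distr_bigA.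
      rewrite [leLHS]big_mkcond; apply: ler_sum => f _; case: ifP => // _.
      exact: prodr_ge0.
    by apply: exprn_ile1; [exact: sumr_ge0|exact: (partial_sum_le1 P_good)].
  apply: (@sum_indic_pairs _ (fun ij : 'I_m * 'I_m => ij.1 != ij.2) _ i j) => //=.
  by rewrite indicE mem_set.
rewrite [X in _ - X]big1 ?subr0 => [|[i j] /= ij]; last first.
  by rewrite indicE memNset// => aij; apply: noij; exists i, j.
rewrite le_eqVlt; apply/orP; left; apply/eqP; apply: eq_bigl => f.
pose h (i : 'I_m) := code Sep N (x i w).
have hinj : injective h.
  move=> i j hij; apply: contrapT => /eqP ij; apply: noij; by exists i, j.
rewrite -(card_imset _ hinj) -imset_comp.
suff -> : g f @: [set: 'I_n]%SET = (h \o f) @: [set: 'I_n]%SET by [].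
by apply: eq_imset => i; rewrite /g /= ffunE.
Qed.

(** At level N the mass minus [e N] is at most the coded mass, which is at most the probability that
    the sample visits k cells, itself at most the probability on the right plus [e' N]. As N grows,
    [e] vanishes because the atoms are almost surely distinct, and [e'] because agreement at all
    levels is equality. *)
Lemma distinct_values_ge m k :
  distinct_mass P D n m k <= pr [set w | distinct_values Y w = k].
Proof.
pose Ex (f : Omega -> R) := (\int[Pr]_(w in D) f w)%R.
(* e N and e' N bound the probabilities that the N-th partition fails to separate
   the atoms, respectively the sample. *)
pose e N := \sum_(ij : 'I_m * 'I_m | ij.1 != ij.2) pr (agree Sep N (x ij.1) (x
  ij.2)).
pose e' N := \sum_(ij : 'I_n * 'I_n) (pr (agree Sep N (Y ij.1) (Y ij.2)) -
     pr [set w | Y ij.1 w = Y ij.2 w]).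
have bagree N X Z : measurable_fun setT X -> measurable_fun setT Z ->
    bounded_meas D (\1_(agree Sep N X Z) : Omega -> R).
  by move=> mX mZ; apply: bounded_meas_indic; exact: measurable_agree.
have beq i j : bounded_meas D (\1_[set w | Y i w = Y j w] : Omega -> R).
  by apply: bounded_meas_indic; exact: (measurable_eq_set mSep Sep_inj).
have bK : bounded_meas D (\1_[set w | distinct_values Y w = k] : Omega -> R).
  by apply: bounded_meas_indic; exact: (measurable_distinct_values mSep Sep_inj R).
have mB N (c : {ffun 'I_n -> {ffun 'I_N -> bool}}) i : measurable [set t | code Sep
  N t = c i].
  exact: measurable_cell.
have mE N (c : {ffun 'I_n -> {ffun 'I_N -> bool}}) :
    measurable (\bigcap_(i in [set: 'I_n]) Y i @^-1` [set t | code Sep N t = c i]).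
  apply: fin_bigcap_measurable => // i _; rewrite -[X in measurable X]setTI.
  exact: mY.
have bPx m' N (c : {ffun 'I_n -> {ffun 'I_N -> bool}}) : bounded_meas D
    (fun w => \prod_i \sum_(j < m') P j w * \1_[set t | code Sep N t =
      c i] (x j w)).
  apply: bounded_meas_prod => i; apply: bounded_meas_sum => j.
  apply: bounded_measM; first exact: bounded_meas_P.
  split; first by apply: measurableT_comp => //; exact: measurable_indic.
  by exists 1 => w _; rewrite ger0_norm indicE;
    case/andP: (ler01_bool R (x j w \in [set t | code Sep N t = c i])).
have le_N N : distinct_mass P D n m k - e N - e' N <= pr [set w | distinct_values Y
  w = k].
  rewrite lerBlDr; apply: (@le_trans _ _ (\int[Pr]_(w in D)
      \sum_(c : {ffun 'I_n -> {ffun 'I_N -> bool}} | #|c @: [set: 'I_n]%SET| == k)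
      \prod_i \sum_(j < m) P j w * \1_[set t | code Sep N t = c i] (x j w))%R).
    rewrite /distinct_mass.
    have -> : e N = (\int[Pr]_(w in D)
        \sum_(ij : 'I_m * 'I_m | ij.1 != ij.2) \1_(agree Sep N (x ij.1) (x ij.2))
          w)%R.
      rewrite (Rintegral_bsum Pr mD) => [|ij]; last exact: bagree.
      apply: eq_bigr => ij _; rewrite (Rintegral_indicE mD DC0)//.
      exact: measurable_agree.
    have b1 : bounded_meas D (fun w =>
        \sum_(f : {ffun 'I_n -> 'I_m} | #|f @: [set: 'I_n]%SET| == k) \prod_i P (f
          i) w).
      by apply: bounded_meas_sum => f; exact: bounded_meas_prodP.
    have b2 : bounded_meas D (fun w => \sum_(ij : 'I_m * 'I_m | ij.1 != ij.2)
        \1_(agree Sep N (x ij.1) (x ij.2)) w : R).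
      by apply: bounded_meas_sum => ij; exact: bagree.
    rewrite -RintegralB//; [|exact: bounded_meas_integrable..].
    apply: le_Rintegral => //.
    - apply: bounded_meas_integrable => //; apply: bounded_measD => //.
      by apply: bounded_measN.
    - by apply: bounded_meas_integrable => //; apply: bounded_meas_sum => c.
    - by move=> w Dw; exact: coded_mass_ge.
  apply: (@le_trans _ _ (\int[Pr]_(w in D)
      \sum_(c : {ffun 'I_n -> {ffun 'I_N -> bool}} | #|c @: [set: 'I_n]%SET| == k)
      \1_(\bigcap_(i in [set: 'I_n]) Y i @^-1` [set t | code Sep N t = c i]) w)%R).
    rewrite (Rintegral_bsum Pr mD) => [|c]; last exact: bPx.
    rewrite (Rintegral_bsum Pr mD) => [|c]; last exact: bounded_meas_indic.
    apply: ler_sum => c _; rewrite (Rintegral_indicE mD DC0)//.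
    exact: sample_law_ge.
  have bdiff (ij : 'I_n * 'I_n) : bounded_meas D (fun w =>
    \1_(agree Sep N (Y ij.1) (Y ij.2)) w -
     \1_[set w | Y ij.1 w = Y ij.2 w] w : R).
    by apply: bounded_measD; [exact: bagree|exact: bounded_measN].
  have -> : pr [set w | distinct_values Y w = k] + e' N = (\int[Pr]_(w in D)
      (\1_[set w | distinct_values Y w = k] w +
       \sum_(ij : 'I_n * 'I_n) (\1_(agree Sep N (Y ij.1) (Y ij.2)) w -
          \1_[set w | Y ij.1 w = Y ij.2 w] w)))%R.
    rewrite RintegralD//; [|exact: bounded_meas_integrable|]; last first.
      by apply: bounded_meas_integrable => //; exact: bounded_meas_sum.
    rewrite (Rintegral_indicE mD DC0); last exact: (measurable_distinct_values mSep
      Sep_inj R).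
    rewrite (Rintegral_bsum Pr mD)//; congr (_ + _); apply: eq_bigr => ij _.
    rewrite RintegralB//; [|apply: bounded_meas_integrable => //;
      exact: bagree|exact: bounded_meas_integrable].
    rewrite !(Rintegral_indicE mD DC0)//;
      [exact: (measurable_eq_set mSep Sep_inj)|exact: measurable_agree].
  apply: le_Rintegral => //.
  - by apply: bounded_meas_integrable => //; apply: bounded_meas_sum => c;
    exact: bounded_meas_indic.
  - by apply: bounded_meas_integrable => //; apply: bounded_measD => //;
    exact: bounded_meas_sum.
  - by move=> w Dw; exact: coded_samples_le.
have e0 : e N @[N --> \oo] --> (0 : R).
  rewrite -[X in _ --> X](_ : \sum_(ij : 'I_m * 'I_m | ij.1 != ij.2)
      pr [set w | x ij.1 w = x ij.2 w] = 0); last first.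
    by apply: big1 => ij ijN; rewrite x_distinct.
  by apply: cvg_big_sum => ij; exact: cvg_agree.
have e'0 : e' N @[N --> \oo] --> (0 : R).
  rewrite -[X in _ --> X](_ : \sum_(ij : 'I_n * 'I_n)
      (pr [set w | Y ij.1 w = Y ij.2 w] - pr [set w | Y ij.1 w = Y ij.2 w]) = 0);
        last first.
    by apply: big1 => ij _; rewrite subrr.
  apply: cvg_big_sum => ij; apply: cvgB; last exact: cvg_cst.
  exact: cvg_agree.
have : (fun N => distinct_mass P D n m k - e N - e' N) @ \oo --> distinct_mass P D
  n m k - 0 - 0.
  by apply: cvgB => //; apply: cvgB => //; exact: cvg_cst.
rewrite !subr0 => c; apply: (cvgr_to_le c); exact: nearW.
Qed.

Lemma sum_distinct_values : \sum_(k < n.+1) pr [set w | distinct_values Y w = k] =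
  1.
Proof.
have bK k : bounded_meas D (\1_[set w | distinct_values Y w = k] : Omega -> R).
  by apply: bounded_meas_indic; exact: (measurable_distinct_values mSep Sep_inj R).
transitivity (\int[Pr]_(w in D) \sum_(k < n.+1) \1_[set w | distinct_values Y w =
  k] w : R)%R.
  rewrite (Rintegral_bsum Pr mD)//; apply: eq_bigr => k _.
  by rewrite (Rintegral_indicE mD DC0)//;
    exact: (measurable_distinct_values mSep Sep_inj R).
rewrite (@eq_Rintegral _ _ _ _ D (cst 1)) => [|w _].
  by rewrite Rintegral_cst// -[fine (_ D)]/(fine (Pr D)) (full_measure mD DC0)
    mul1r.
rewrite (bigD1 (Ordinal (distinct_values_le Y w)))//= big1 ?addr0 => [|k kK].
  by rewrite indicE mem_set.
rewrite indicE memNset// => /= Kk; case/eqP: kK; exact/val_inj.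
Qed.

Lemma distinct_values_law k : (k < n.+1)%N ->
  Pr [set w | distinct_values Y w = k] = (distinct_prob P n k)%:E.
Proof.
move=> kn.
have ge j : (j < n.+1)%N -> distinct_prob P n j <= pr [set w | distinct_values Y w
  = j].
  move=> jn; apply: (cvgr_to_le (cvg_distinct_prob mD DC0 P_good jn)).
  by apply: nearW => m; exact: distinct_values_ge.
suff : pr [set w | distinct_values Y w = k] <= distinct_prob P n k.
  move=> le; rewrite -[LHS]fineK; last first.
    by rewrite fin_num_measure//; exact: (measurable_distinct_values mSep Sep_inj
      R).
  by congr EFin; apply/le_anti; rewrite le ge.
have := sum_distinct_values; rewrite -(distinct_prob_sum mD DC0 P_good n).
rewrite (bigD1 (Ordinal kn))//= [in RHS](bigD1 (Ordinal kn))//= => E.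
rewrite -(lerD2r (\sum_(i < n.+1 | i != Ordinal kn) distinct_prob P n i)) -E.
by rewrite lerD2l; apply: ler_sum => i _; exact: ge.
Qed.

End SampleCount.

(** * Conclusion *)

Lemma poly_eq0_itv01 (R : realType) (p : {poly R}) :
  (forall v : R, 0 <= v <= 1 -> p.[v] = 0) -> p = 0.
Proof.
(* The points 1, 1/2, 1/3, ... lie in [0, 1] and supply [size p] distinct roots, one more than a
   nonzero p can have. *)
move=> p0; pose rs := [seq (i.+1%:R : R)^-1 | i <- iota 0 (size p)].
apply: (@roots_geq_poly_eq0 _ p rs); last by rewrite size_map size_iota.
  apply/allP => _ /mapP[i _ ->]; apply/eqP/p0.
  by rewrite invr_ge0 ler0n/= invf_le1// ler1n.
rewrite map_inj_uniq ?iota_uniq// => i j /invr_inj/eqP.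
by rewrite eqr_nat => /eqP[].
Qed.

Section OneMarking.
Context d (Omega : measurableType d) (R : realType) (Pr : probability Omega R).
Variables P U : nat -> {RV Pr >-> R}.
Hypothesis PU : uniform_marking P U.

(** The almost sure hypothesis provides a measurable null set containing the exceptional points; D
    is its complement. *)
Lemma good_event : exists D : set Omega, [/\ measurable D, Pr (~` D) = 0%E &
  forall w, D w -> (forall j, 0 <= P j w) /\ (\sum_(0 <= j <oo) (P j w)%:E = 1)%E].
Proof.
have [[N [mN N0 PN]] _ _] := PU; exists (~` N); split; first exact: measurableC.
  by rewrite setCK.
by move=> w; apply: contra_notP => /PN.
Qed.

Lemma distinct_count_law n (K : Omega -> nat) : distinct_count P U n K ->
  [/\ forall k, measurable [set w | K w = k], forall w, (K w < n.+1)%N &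
   forall k, (k < n.+1)%N -> Pr [set w | K w = k] = (distinct_prob P n k)%:E].
Proof.
have [D [mD DC0 P_good]] := good_event; have [_ iidU indPU] := PU.
(* Conditioning on the whole space turns the conditional law of the sample into its joint law on
   products, the form in which [distinct_values_law] takes it. *)
have sT (I : Type) (J : set I) (Z : I -> Omega -> R) : sigma_of J Z setT.
  exact: (@measurableT _ (g_sigma_algebraType
    (\bigcup_(i in J) preimage_set_system setT (Z i) measurable))).
case=> [[X [sX ->]]|[Y [sY ->]]].
(* For samples from P the atoms are the integers themselves, separated by singletons. *)
- pose Sep (i : nat) : set nat := [set i].
  have Sep_inj (s t : nat) : (forall i, Sep i s <-> Sep i t) -> s = t.
    by move=> /(_ t)[_]; exact.
  have mSep i : measurable (Sep i) by [].
  have mX i : measurable_fun setT (X i : Omega -> nat) by exact: measurable_funP.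
  split; [|exact: distinct_values_le|] => k.
    exact: (measurable_distinct_values mSep Sep_inj R).
  move=> kn; apply: (distinct_values_law mD DC0 P_good mSep Sep_inj (x := fun j _
    => j)) => //.
  + move=> i j ij; rewrite (_ : [set _ | _] = set0) ?measure0//.
    by apply/seteqP; split => // w /= /eqP; rewrite (negbTE ij).
  + move=> B mB; rewrite -[X in Pr X]setTI; exact: sX.
(* Rays with rational endpoints separate reals. The rationals are enumerated by [unpickle]; an index
   that decodes to nothing merely repeats the ray at 0. *)
- pose Sep (i : nat) : set R := `]-oo, ratr (odflt 0 (unpickle i))]%classic.
  have Sep_lt (s t : R) : s < t -> exists i, Sep i s /\ ~ Sep i t.
    move=> /rat_in_itvoo[q]; rewrite in_itv/= => /andP[sq qt].
    exists (pickle q); rewrite /Sep pickleK/= !in_itv/= ltW//; split => //.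
    by apply/negP; rewrite -ltNge.
  have Sep_inj (s t : R) : (forall i, Sep i s <-> Sep i t) -> s = t.
    move=> st; have [/Sep_lt[i [si ti]]|/Sep_lt[i [ti si]]|//] := ltgtP s t.
      by case: ti; apply/st.
    by case: si; apply/st.
  have mSep i : measurable (Sep i) by exact: measurable_itv.
  have mY i : measurable_fun setT (Y i : Omega -> R) by exact: measurable_funP.
  split; [|exact: distinct_values_le|] => k.
    exact: (measurable_distinct_values mSep Sep_inj R).
  move=> kn; apply: (distinct_values_law mD DC0 P_good mSep Sep_inj (x := fun j =>
    U j : Omega -> R)) => //.
  + by move=> i j ij; exact: uniform_distinct.
  + move=> B mB; rewrite -[X in Pr X]setTI; exact: sY.
Qed.

Lemma expectation_cdfX n v : 0 <= v <= 1 ->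
  ('E_Pr[(fun w => random_cdf P U v w ^+ n)%R])%E =
  (\sum_(k < n.+1) distinct_prob P n k * v ^+ k)%:E.
Proof.
move=> v01; have [D [mD DC0 P_good]] := good_event; have [_ iidU indPU] := PU.
rewrite (expectation_fullE mD DC0) ?(random_cdf_moment mD DC0 P_good)//.
by apply: bounded_measX; exact: bounded_meas_random_cdf.
Qed.

Lemma indic_sum_levels n (K : Omega -> nat) (F : nat -> R) w : (K w < n.+1)%N ->
  F (K w) = \sum_(k < n.+1) F k * \1_[set w | K w = k] w.
Proof.
move=> Kn; rewrite (bigD1 (Ordinal Kn))//= [X in _ + X]big1 ?addr0 => [|k kK].
  by rewrite indicE mem_set// mulr1.
by rewrite indicE memNset ?mulr0// => /= Kk; case/eqP: kK; exact/val_inj.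
Qed.

Lemma Rintegral_distinct_count n (K : Omega -> nat) (F : nat -> R) D :
  measurable D -> Pr (~` D) = 0%E ->
  distinct_count P U n K ->
  bounded_meas D (F \o K) /\
  (\int[Pr]_(w in D) F (K w))%R = \sum_(k < n.+1) F k * distinct_prob P n k.
Proof.
move=> mD DC0 /distinct_count_law[mK Kn KE].
have b k : bounded_meas D (fun w => F k * \1_[set w | K w = k] w).
  by apply: bounded_measM; [exact: bounded_meas_cst|exact: bounded_meas_indic].
have FE : F \o K = fun w => \sum_(k < n.+1) F k * \1_[set w | K w = k] w.
  by apply/funext => w; exact: indic_sum_levels.
split; first by rewrite FE; exact: bounded_meas_sum.
rewrite -[X in Rintegral _ _ X]/(F \o K) FE (Rintegral_bsum Pr mD)//.
apply: eq_bigr => k _; rewrite RintegralZl//.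
  by rewrite (Rintegral_indicE mD DC0)// KE.
by apply: bounded_meas_integrable => //; exact: bounded_meas_indic.
Qed.

Lemma expectation_distinct_count n (K : Omega -> nat) v : distinct_count P U n K ->
  ('E_Pr[(fun w => v ^+ K w)%R])%E =
  (\sum_(k < n.+1) distinct_prob P n k * v ^+ k)%:E.
Proof.
have [D [mD DC0 P_good]] := good_event => cK.
have [b E] := Rintegral_distinct_count (fun k => v ^+ k) mD DC0 cK.
rewrite (expectation_fullE mD DC0)// E; congr EFin.
by apply: eq_bigr => k _; rewrite mulrC.
Qed.

Lemma distinct_count_preimage n (K : Omega -> nat) (B : set nat) :
  distinct_count P U n K ->
  Pr (K @^-1` B) = (\sum_(k < n.+1) \1_B k * distinct_prob P n k)%:E.
Proof.
have [D [mD DC0 P_good]] := good_event => cK.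
have [b <-] := Rintegral_distinct_count (\1_B) mD DC0 cK.
have [mK Kn _] := distinct_count_law cK.
have mB : measurable (K @^-1` B).
  rewrite (_ : _ @^-1` _ = \bigcup_(k in `I_n.+1 `&` B) [set w | K w = k]).
    by apply: bigcup_measurable => k _.
  apply/seteqP; split => [w Bw|w [k [_ Bk] /= Kk]]; last by rewrite /preimage/= Kk.
  by exists (K w) => //; split => //; exact: Kn.
rewrite -[LHS]fineK ?fin_num_measure//; congr EFin.
by rewrite -(Rintegral_indicE mD DC0)//.
Qed.

Lemma measurable_cdf_RV v : measurable_fun setT (random_cdf P U v).
Proof. exact: measurable_random_cdf. Qed.

Definition cdf_RV v : {RV Pr >-> R} :=
  HB.pack (random_cdf P U v) (isMeasurableFun.Build _ _ _ _ _ (measurable_cdf_RV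
    v)).

Lemma cdf_RV_itv01 v : distribution Pr (cdf_RV v) `[0, 1]%classic = 1%E.
Proof.
have [D [mD DC0 P_good]] := good_event.
apply/le_anti/andP; split; first exact: probability_le1.
rewrite -(full_measure mD DC0); apply: le_measure; rewrite ?inE//.
  by rewrite -[X in measurable X]setTI; exact: measurable_cdf_RV.
by move=> w Dw; rewrite /= in_itv/=; exact: (random_cdf_itv U P_good v Dw).
Qed.

Lemma cdf_RV_moment n v : 0 <= v <= 1 ->
  (\int[distribution Pr (cdf_RV v)]_(y in `[0, 1]) y ^+ n)%R =
  \sum_(k < n.+1) distinct_prob P n k * v ^+ k.
Proof.
move=> v01; have [D [mD DC0 P_good]] := good_event; have [_ iidU indPU] := PU.
rewrite -(random_cdf_moment mD DC0 P_good n iidU indPU v01); apply: EFin_inj.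
rewrite -(Rintegral_fullE mD DC0); last first.
  by apply: bounded_measX; exact: bounded_meas_random_cdf.
(* The change of variables yields an integral over this preimage instead of D; both events have
   probability one, so each integral equals the one over the whole space. *)
pose F01 := random_cdf P U v @^-1` `[0, 1]%classic.
have mF01 : measurable F01.
  by rewrite -[X in measurable X]setTI; exact: measurable_cdf_RV.
have F01C : Pr (~` F01) = 0%E.
  by rewrite probability_setC// [X in (_ - X)%E](cdf_RV_itv01 v) subee.
have bF : bounded_meas F01 (fun w => random_cdf P U v w ^+ n).
  apply: bounded_measX; split; first exact: measurable_cdf_RV.
  by exists 1 => w; rewrite /F01/= in_itv/= => /andP[F0 F1]; rewrite ger0_norm.
rewrite (Rintegral_fullE mF01 F01C)//; congr EFin.
rewrite /Rintegral ge0_integral_pushforward//.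
- by apply/measurable_EFinP; apply: measurable_funX; exact: measurable_id.
- by move=> y /set_mem/=; rewrite in_itv/= => /andP[y0 _];
  rewrite lee_fin exprn_ge0.
Qed.

End OneMarking.

Theorem proposition10 (R : realType) :
  (forall (d : measure_display) (Omega : measurableType d)
      (Pr : probability Omega R) (P U : nat -> {RV Pr >-> R}),
    uniform_marking P U ->
    forall n : nat, (0 < n)%N ->
      (exists q : {poly R}, (size q <= n.+1)%N /\
         forall v : R, 0 <= v <= 1 ->
           ('E_Pr[(fun w => random_cdf P U v w ^+ n)%R] = q.[v]%:E)%E) /\
      forall K : Omega -> nat, distinct_count P U n K ->
        (forall v : R, 0 <= v <= 1 ->
           ('E_Pr[(fun w => random_cdf P U v w ^+ n)%R] =
            'E_Pr[(fun w => v ^+ K w)%R])%E /\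
           ('E_Pr[(fun w => v ^+ K w)%R] =
            \sum_(1 <= k < n.+1) Pr [set w | K w = k] * (v ^+ k)%:E)%E) /\
        (forall k : nat, (1 <= k <= n)%N ->
           Pr [set w | K w = k] =
             (\sum_(c in compositions n k)
                ecpf P (fun i => nat_of_ord (c i)))%E /\
           #|compositions n k| = 'C(n.-1, k.-1)))
  /\
  (forall (d1 d2 : measure_display)
      (Omega1 : measurableType d1) (Omega2 : measurableType d2)
      (Pr1 : probability Omega1 R) (Pr2 : probability Omega2 R)
      (P1 U1 : nat -> {RV Pr1 >-> R}) (P2 U2 : nat -> {RV Pr2 >-> R})
      (K1 : nat -> Omega1 -> nat) (K2 : nat -> Omega2 -> nat),
    uniform_marking P1 U1 -> uniform_marking P2 U2 ->
    (forall n : nat, (0 < n)%N -> distinct_count P1 U1 n (K1 n)) ->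
    (forall n : nat, (0 < n)%N -> distinct_count P2 U2 n (K2 n)) ->
    ((forall n : nat, (0 < n)%N -> same_law Pr1 Pr2 (K1 n) (K2 n)) <->
     (forall v : R, 0 <= v <= 1 ->
        same_law Pr1 Pr2 (random_cdf P1 U1 v) (random_cdf P2 U2 v)))).
Proof.
split=> [d Omega Pr P U PU n n0|d1 d2 Omega1 Omega2 Pr1 Pr2 P1 U1 P2 U2 K1 K2 PU1
  PU2 cK1 cK2].
  have [D [mD DC0 P_good]] := good_event PU.
  split.
    exists (\poly_(k < n.+1) distinct_prob P n k); split; first exact: size_poly.
    by move=> v v01; rewrite (expectation_cdfX PU)// horner_poly.
  move=> K cK; have [mK Kn KE] := distinct_count_law PU cK.
  split=> [v v01|k /andP[k1 kn]].
    rewrite (expectation_cdfX PU)// (expectation_distinct_count PU v cK);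
      split => //.
    (* The term k = 0 is split off and vanishes: a positive n has no composition into zero parts. *)
    rewrite -(big_mkord xpredT (fun k => distinct_prob P n k * v ^+ k)).
    rewrite big_ltn// (distinct_prob0 P n0) mul0r add0r -sumEFin.
    by apply: eq_big_nat => k /andP[_ kn]; rewrite EFinM KE.
  rewrite KE// (distinct_probE mD DC0 P_good)//; split => //.
  by rewrite card_compositions// k1.
have [D1 [mD1 D1C0 P1_good]] := good_event PU1.
have [D2 [mD2 D2C0 P2_good]] := good_event PU2.
split=> [sK v v01 B mB|sF n n0 B mB].
  have probE n : \sum_(k < n.+1) distinct_prob P1 n k * v ^+ k =
      \sum_(k < n.+1) distinct_prob P2 n k * v ^+ k.
    (* The counts are compared for positive n only; for n = 0 both sides equal 1 by
       normalization. *)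
    case: n => [|n].
      have := distinct_prob_sum mD1 D1C0 P1_good 0.
      rewrite -(distinct_prob_sum mD2 D2C0 P2_good 0) !big_ord_recl !big_ord0.
      by rewrite !addr0 => ->.
    apply: eq_bigr => k _; congr (_ * _); apply: EFin_inj.
    have [_ _ <-//] := distinct_count_law PU1 (cK1 n.+1 isT).
    have [_ _ <-//] := distinct_count_law PU2 (cK2 n.+1 isT).
    exact: (sK n.+1 isT [set val k]).
  apply: (moments_unique (mu1 := distribution Pr1 (cdf_RV P1 U1 v))
    (mu2 := distribution Pr2 (cdf_RV P2 U2 v))) => //.
  - exact: cdf_RV_itv01.
  - exact: cdf_RV_itv01.
  - by move=> n; rewrite !cdf_RV_moment// probE.
have probE v : 0 <= v <= 1 -> \sum_(k < n.+1) distinct_prob P1 n k * v ^+ k =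
    \sum_(k < n.+1) distinct_prob P2 n k * v ^+ k.
  move=> v01; rewrite -(cdf_RV_moment PU1)// -(cdf_RV_moment PU2)//.
  congr fine; apply: eq_measure_integral => A mA _; exact: sF.
(* Equal laws of F(v) give equal n-th moments for every v in [0, 1], so q vanishes there and hence
   identically; its coefficients compare the two laws of K_n. *)
pose q : {poly R} := \poly_(k < n.+1) distinct_prob P1 n k - \poly_(k < n.+1)
  distinct_prob P2 n k.
have q0 : q = 0.
  by apply: poly_eq0_itv01 => v v01; rewrite hornerD hornerN !horner_poly probE//
    subrr.
rewrite (distinct_count_preimage PU1 B (cK1 n n0)) (distinct_count_preimage PU2 B
  (cK2 n n0)).
congr EFin; apply: eq_bigr => k _; congr (_ * _).
have : q`_k = 0 by rewrite q0 coef0.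
by rewrite coefB !coef_poly ltn_ord => /eqP; rewrite subr_eq0 => /eqP.
Qed.
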